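(* Let $\mu\in(k-1,k]$ with $k\in\mathbb N$, $k\ge1$, let $m\ge0$ be an integer, and assume that $u$ is of AC-BV$_{\mu,m}$-regularity on $[-1,1]$, with $v_\mu:={}^{C}\!D_{-1+}^{\mu}u$. Then for every integer $n\ge\mu+m+1$, the Legendre expansion coefficient $\hat u_n^L=\frac{2n+1}{2}\int_{-1}^1u(x)P_n(x)\,\mathrm dx$ satisfies $$\hat u_n^L=\frac{2n+1}{2}\bigg\{\sum_{l=0}^m(I_{1-}^{\mu+l+1}P_n)(-1)\,v_\mu^{(l)}(-1+)+\int_{-1}^1(I_{1-}^{\mu+m+1}P_n)(x)\,\mathrm d\{v_\mu^{(m)}(x)\}\bigg\},$$ where, for $0\le l\le m$, $$(I_{1-}^{\mu+l+1}P_n)(-1)=\frac{(-1)^n2^{\mu+l+1}\,\Gamma(\mu+l+1)\sin((\mu+l+1)\pi)}{\pi}\,\frac{\Gamma(n-\mu-l)}{\Gamma(n+\mu+l+2)}.$$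
   Context: $P_n$ is the Legendre polynomial of degree $n$. $\mathrm{AC}$ and $\mathrm{BV}$ denote absolutely continuous functions and functions of bounded variation on $[-1,1]$. Fractional integrals: for $\rho>0$ and $f\in L^1(-1,1)$, $(I_{-1+}^\rho f)(x)=\frac1{\Gamma(\rho)}\int_{-1}^x\frac{f(y)}{(x-y)^{1-\rho}}\,\mathrm dy$ and $(I_{1-}^\rho f)(x)=\frac1{\Gamma(\rho)}\int_x^1\frac{f(y)}{(y-x)^{1-\rho}}\,\mathrm dy$; $I^0$ is the identity. Caputo derivative: for $\mu\in(k-1,k]$, ${}^{C}\!D_{-1+}^{\mu}u=I_{-1+}^{k-\mu}u^{(k)}$. AC-BV$_{\mu,m}$-regularity of $u$ (with $\mu\in(k-1,k]$) means: $u,\dots,u^{(k-1)}\in\mathrm{AC}([-1,1])$; $v_\mu:={}^{C}\!D_{-1+}^{\mu}u\in\mathrm{BV}([-1,1])$; and moreover $v_\mu,\dots,v_\mu^{(m-1)}\in\mathrm{AC}([-1,1])$ and $v_\mu^{(m)}\in\mathrm{BV}([-1,1])$. (Functions defined only a.e. are identified with their AC or BV representative.) $h(-1+)$ denotes the right limit at $-1$. For $h\in\mathrm{BV}([-1,1])$ and $\varphi$ continuous, $\int_{-1}^1\varphi\,\mathrm dh$ is the Riemann–Stieltjes integral taken without jump contributions at the endpoints, i.e. with $h(\pm1)$ understood as the one-sided limits (integral over the open interval $(-1,1)$). *)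

(* Defs.v *)
From mathcomp Require Import all_boot all_order all_algebra.
From mathcomp Require Import all_classical all_reals all_analysis.
Set Implicit Arguments.
Unset Strict Implicit.
Unset Printing Implicit Defensive.
Import Order.TTheory GRing.Theory Num.Theory.
Import numFieldNormedType.Exports.
Local Open Scope classical_set_scope.
Local Open Scope ring_scope.

(* Functions on [-1, 1] are total functions R -> R whose values outside
   [-1, 1] are irrelevant. *)

(* Rodrigues' formula *)
Definition legendre (R : realType) (n : nat) : {poly R} :=
  (2 ^+ n * n`!%:R)^-1 *: derivn n (('X ^+ 2 - 1) ^+ n).

Definition legendre_coeff (R : realType) (u : R -> R) (n : nat) : R :=
  (2 * n%:R + 1) / 2 *
  \int[lebesgue_measure]_(x in `[-1, 1]) (u x * (legendre R n).[x]).

(* Only meaningful for z > 0, where the integral converges. *)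
Definition Gamma (R : realType) (z : R) : R :=
  \int[lebesgue_measure]_(t in `]0, +oo[) (t `^ (z - 1) * expR (- t)).

(* Left-sided integral I_{-1+}^rho, for rho >= 0 *)
Definition fracintL (R : realType) (rho : R) (f : R -> R) (x : R) : R :=
  if rho == 0 then f x
  else (Gamma rho)^-1 *
       \int[lebesgue_measure]_(y in `]-1, x[) (f y / (x - y) `^ (1 - rho)).

(* Right-sided integral I_{1-}^rho, for rho >= 0 *)
Definition fracintR (R : realType) (rho : R) (f : R -> R) (x : R) : R :=
  if rho == 0 then f x
  else (Gamma rho)^-1 *
       \int[lebesgue_measure]_(y in `]x, 1[) (f y / (y - x) `^ (1 - rho)).

(* Caputo derivative of order mu, for mu in (k - 1, k]. Where u^(k) does not
   exist (a null set when u^(k-1) is absolutely continuous) derive1n takes a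
   default value, so this is meaningful up to a.e. equality. *)
Definition caputo (R : realType) (k : nat) (mu : R) (u : R -> R) : R -> R :=
  fracintL (k%:R - mu) (derive1n k u).

Definition abs_continuous (R : realType) (a b : R) (f : R -> R) : Prop :=
  forall eps : R, 0 < eps -> exists2 delta : R, 0 < delta &
    forall (N : nat) (l r : 'I_N -> R),
      (forall i, [/\ a <= l i, l i <= r i & r i <= b]) ->
      trivIset setT (fun i => `]l i, r i[%classic) ->
      \sum_(i < N) (r i - l i) < delta ->
      \sum_(i < N) `|f (r i) - f (l i)| < eps.

(* AC-BV_{mu,m}-regularity of u on [-1, 1], where mu in (k - 1, k].
   Derivatives and the Caputo derivative are only defined a.e. and are
   identified with their AC or BV representatives: for l <= m, v l is such a
   representative of the l-th derivative of v_mu = caputo k mu u. *)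
Definition AC_BV_regular (R : realType) (k : nat) (mu : R) (m : nat)
    (u : R -> R) (v : nat -> R -> R) : Prop :=
  [/\ abs_continuous (-1) 1 u,
      forall j, (0 < j < k)%N -> exists2 w : R -> R, abs_continuous (-1) 1 w &
        w = derive1n j u %[ae lebesgue_measure in `]-1, 1[%classic],
      v 0%N = caputo k mu u %[ae lebesgue_measure in `]-1, 1[%classic]
        /\ bounded_variation (-1) 1 (v 0%N),
      forall l, (l < m)%N -> abs_continuous (-1) 1 (v l) /\
        v l.+1 = derive1 (v l) %[ae lebesgue_measure in `]-1, 1[%classic]
    & bounded_variation (-1) 1 (v m)].

(* J is the Riemann-Stieltjes integral of phi with respect to h over [a, b]
   (limit of tagged sums as the mesh tends to 0). A partition
   a < s_0 < ... < s_(N-1) = b is given by the list s of its points after a,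
   and t i is the tag of its i-th cell. *)
Definition is_RSint (R : realType) (a b : R) (phi h : R -> R) (J : R) : Prop :=
  forall eps : R, 0 < eps -> exists2 delta : R, 0 < delta &
    forall (s : seq R) (t : nat -> R),
      let x := nth b (a :: s) in
      itv_partition a b s ->
      (forall i, (i < size s)%N ->
        x i.+1 - x i < delta /\ x i <= t i <= x i.+1) ->
      `|\sum_(i < size s) phi (t i) * (h (x i.+1) - h (x i)) - J| < eps.

(* h with its values at a and b replaced by the one-sided limits, so that
   integrating against it gives no jump contribution at the endpoints *)
Definition endpoint_limits (R : realType) (a b : R) (h : R -> R) (x : R) : R :=
  if x == a then lim (h y @[y --> a^'+])
  else if x == b then lim (h y @[y --> b^'-])
  else h x.

(* Main.v *)
(* Expanding P_n in powers of 1 - x gives I_{1-}^rho P_n in closed form, and the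
   Chu-Vandermonde identity evaluates it at -1: up to the factor
   2^rho / Gamma(n + rho + 1), it is (rho - n)(rho - n + 1) ... (rho - 1). This
   vanishes for rho = 1, ..., n, and Euler's reflection formula turns it into
   the stated quotient of Gamma functions.
   Starting from the integral of u P_n, k integrations by parts bring in
   u^(k) and I_{1-}^k P_n without boundary terms. Since
   I_{1-}^k = I_{1-}^(k - mu) I_{1-}^mu, Fubini's theorem moves I_{1-}^(k - mu)
   to u^(k), which becomes v_mu. Then m further integrations by parts and a last
   one of Riemann-Stieltjes type produce the boundary terms and the integral
   with respect to v_mu^(m). *)

From HB Require Import structures.
Require Import Defs.
From mathcomp Require Import all_boot all_order all_algebra.
From mathcomp Require Import all_classical all_reals all_analysis.
From mathcomp Require Import mathcomp_extra measurable_realfun ring lra.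
Set Implicit Arguments.
Unset Strict Implicit.
Unset Printing Implicit Defensive.
Import Order.TTheory GRing.Theory Num.Theory.
Import numFieldNormedType.Exports.
Local Open Scope classical_set_scope.
Local Open Scope ring_scope.

(** * The Gamma function and Euler's beta integral *)

(** All the functions I_{1-}^rho P_n lie in one family, [frac_poly]: combinations of the normalised
    powers (1 - x)^(j + s) / Gamma(j + s + 1), on which I_{1-}^a merely adds a to s. The semigroup
    law and the vanishing at 1 are thus read off from the exponent. Ordinary integration by parts is
    the order 1 case of the Fubini exchange, once an absolutely continuous w is known to be w(-1) +
    I_{-1+}^1 w'; this is what requires the Radon-Nikodym theorem. The boundary terms at -1 for rho
    = 1, ..., k disappear because the bound on n forces k <= n. Two obstacles shape the rest.
    Derivatives and v_mu are known only a.e., with default values elsewhere, so integrals of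
    possibly nonmeasurable functions are compared with those of measurable representatives. And
    Euler's reflection formula is derived from real integrals: sin (s pi) enters through the
    integrals of cos (2 s x) cos^n x, and log-convexity of Gamma squeezes the remaining factor to
    1. *)

Section affine.
Context {R : realType}.
Notation mu := (@lebesgue_measure R).
Implicit Types (f : R -> \bar R).

Definition affine_map (c d : R) : R -> measurableTypeR R := fun y => c * y + d.

Lemma measurable_affine (c d : R) : measurable_fun setT (affine_map c d).
Proof.
apply: continuous_measurable_fun => x; rewrite /affine_map.
by apply: (@continuousD _ R^o); [apply: (@mulrl_continuous R)|exact: cst_continuous].
Qed.

(** The scaled pushforward agrees with Lebesgue measure on half-open intervals, and
    [lebesgue_measure_unique] extends this to all measurable sets. *)
Lemma lebesgue_measure_affine (c d : R) (c0 : 0 < c) (A : set R) : measurable A ->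
  (c%:E * mu (affine_map c d @^-1` A))%E = mu A.
Proof.
move=> mA; apply/esym.
have mf := @measurable_affine c d.
apply: (@lebesgue_measure_unique R (mscale (NngNum (ltW c0)) (pushforward mu (affine_map c d)))) => //= _ [[a b]] _ <-.
rewrite /mscale/= /pushforward.
rewrite (_ : affine_map c d @^-1` _ = `](a - d) / c, (b - d) / c]%classic); last first.
  apply/seteqP; split=> x /=; rewrite !in_itv/= /affine_map ltr_pdivrMr// ler_pdivlMr//;
  by rewrite ltrBlDr lerBrDr mulrC.
rewrite !lebesgue_measure_itv/= !lte_fin ltr_pM2r ?invr_gt0// ltrD2r.
case: ifPn => ab; last by rewrite mule0.
rewrite -!EFinB -EFinM; congr (_ %:E). field. exact: lt0r_neq0.
Qed.

Lemma ge0_integral_affine (c d : R) f : 0 < c ->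
  measurable_fun [set: R] f -> (forall x, 0 <= f x)%E ->
  (\int[mu]_x f x = c%:E * \int[mu]_x f (c * x + d)%R)%E.
Proof.
move=> c0 mf f0; have ma := @measurable_affine c d.

have H : (\int[mu]_x f x = \int[mscale (NngNum (ltW c0)) (pushforward mu (affine_map c d))]_x f x)%E.
  move=> m; apply: eq_measure_integral => //= A mA _; rewrite -(lebesgue_measure_affine d c0 mA).
  by [].
rewrite (H ma) ge0_integral_mscale//=; congr (_ * _)%E.
by rewrite ge0_integral_pushforward.
Qed.
End affine.

Section gamma_fun.
Context {R : realType}.
Notation mu := (@lebesgue_measure R).
Implicit Types a b s t z : R.

(** For z < 1 the integrand blows up at 0, so the fundamental theorem is applied on [1/(i+1), 1] and
    monotone convergence passes to the limit. *)
Lemma integral_powR01 z : 0 < z ->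
  (\int[mu]_(x in `]0%R, 1%R[) (x `^ (z - 1))%:E = (z^-1)%:E)%E.
Proof.
move=> z0.
have mf (D : set R) : measurable_fun D (fun x : R => (x `^ (z - 1))%:E).
  by apply/measurable_EFinP; apply: measurable_funTS; exact: measurable_powR.
rewrite -(@integral_itv_bndoo R 0 1 _ false false)//.
pose F (i : nat) : set R := `[i.+1%:R^-1, 1]%classic.
have -> : `]0, 1]%classic = \bigcup_i F i.
  apply/seteqP; split => [x|x [i _]]; rewrite /F /= !in_itv/=.
    move=> /andP[x0 x1]; exists (Num.truncn x^-1) => //=; rewrite in_itv/= x1 andbT.
    by rewrite invf_ple ?posrE//; apply: ltW; exact: truncnS_gt.
  by move=> /andP[ix ->]; rewrite andbT (lt_le_trans _ ix)// invr_gt0.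
have nd : nondecreasing_seq F.
  move=> i j ij; apply/subsetPset => x; rewrite /F/= !in_itv/= => /andP[ix ->].
  by rewrite andbT (le_trans _ ix)// lef_pV2 ?posrE// ler_nat.

have : ((\int[mu]_(x in F i) (x `^ (z - 1))%:E) @[i --> \oo] --> \int[mu]_(x in \bigcup_i F i) (x `^ (z - 1))%:E)%E.
  apply: ge0_nondecreasing_set_cvg_integral => //.
  - by move=> i; exact: measurable_itv.
  - by move=> i; exact: mf.
  - by move=> *; rewrite lee_fin powR_ge0.
move=> /cvg_lim <- //.
have FE i : (\int[mu]_(x in F i) (x `^ (z - 1))%:E = (z^-1 * (1 - (i.+1%:R^-1) `^ z))%:E)%E.
  rewrite /F; case: i => [|i].
    by rewrite invr1 set_itv1 integral_set1 powR1 subrr mulr0.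
  have i0 : 0 < i.+2%:R^-1 :> R by rewrite invr_gt0.
  rewrite (@continuous_FTC2 _ _ (fun x => z^-1 * x `^ z)).
  - by rewrite powR1 -EFinB -mulrBr.
  - by rewrite invf_lt1// ltr1n.
  - apply: derivable_within_continuous => x; rewrite in_itv/= => /andP[ix _].
    apply: derivable_powR; rewrite in_itv/= andbT. exact: lt_le_trans ix.
  - have dF x : 0 < x -> derivable (fun x => z^-1 * x `^ z) x 1.
      by move=> x0; apply: derivableM => //; apply: derivable_powR; rewrite in_itv/= andbT.
    have cF x : 0 < x -> {for x, continuous (fun x => z^-1 * x `^ z)}.
      by move=> x0; apply: differentiable_continuous; exact/derivable1_diffP/dF.
    split.
    + by move=> x; rewrite in_itv/= => /andP[/(lt_trans i0)/dF].
    + apply: cvg_at_right_filter; exact: cF.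
    + apply: cvg_at_left_filter; exact: cF.
  - move=> x; rewrite in_itv/= => /andP[/(lt_trans i0) x0 _].
    rewrite derive1Ml; last by apply: derivable_powR; rewrite in_itv/= andbT.
    rewrite powR_derive1 ?in_itv/= ?andbT// mulrA mulVf ?mul1r//; exact: lt0r_neq0.
under eq_fun do rewrite FE.
apply/cvg_lim => //; apply: cvg_EFin; first exact: nearW.

suff : z^-1 * (1 - i.+1%:R^-1 `^ z) @[i --> \oo] --> z^-1 * (1 - 0) by rewrite subr0 mulr1.
apply: cvgMr; apply: cvgB; first exact: cvg_cst.
apply: (@cvg_comp _ _ _ (fun i : nat => i.+1%:R^-1 : R) (fun x : R => x `^ z) _ (0:R)^'+); last exact: powR_cvg0.
move=> A [e /= e0 eA]. near=> i. apply: eA => //=.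
rewrite sub0r normrN gtr0_norm ?invr_gt0//. near: i; exact: near_infty_natSinv_lt (PosNum e0).
Unshelve. all: by end_near. Qed.
End gamma_fun.

Section gamma_density.
Context {R : realType}.
Notation mu := (@lebesgue_measure R).
Implicit Types a b s t z : R.

(** Extended by zero to the whole line, so that a product of two Gamma values becomes the integral
    of a convolution. *)
Definition gamma_density a : R -> R :=
  (fun t => t `^ (a - 1) * expR (- t)) \_ `]0, +oo[.

Lemma gamma_density_ge0 a t : 0 <= gamma_density a t.
Proof.
by apply: restrict_ge0 => {}t _; rewrite mulr_ge0 ?powR_ge0 ?expR_ge0.
Qed.

Lemma gamma_densityE a t : 0 < t -> gamma_density a t = t `^ (a - 1) * expR (- t).
Proof. by move=> t0; rewrite /gamma_density patchE mem_set//= in_itv/= t0. Qed.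

Lemma gamma_density0 a t : t <= 0 -> gamma_density a t = 0.
Proof.
move=> t0; rewrite /gamma_density patchE memNset//=.
by rewrite in_itv/= andbT; apply/negP; rewrite -leNgt.
Qed.

Lemma measurable_gamma_density a : measurable_fun [set: R] (gamma_density a).
Proof.
apply/measurable_restrict => //; apply: measurable_funTS.
apply: measurable_funM; first exact: measurable_powR.
by apply: measurableT_comp => //.
Qed.

Lemma GammaE a : Gamma a = fine (\int[mu]_t (gamma_density a t)%:E).
Proof. by rewrite /Gamma Rintegral_mkcond. Qed.

(** Near 0 the factor expR (- t) is at most 1. Beyond 1, half of the exponential absorbs the power,
    by t^(a - 1) <= t^q and t <= 2q expR (t / (2q)). The other half is left as an exponential
    density of rate 1/2, whose normalisation accounts for the factor 2 in C. *)
Lemma gamma_density_le a : exists2 C, 0 <= C & forall t,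
  gamma_density a t <= ((fun x : R => x `^ (a - 1)) \_ `]0, 1[) t +
     C * exponential_pdf 2^-1 t.
Proof.
pose q : R := `|a| + 1; have q0 : 0 < q by rewrite /q ltr_wpDl.
exists (2 * (2 * q) `^ q) => [|t]; first by rewrite mulr_ge0 ?powR_ge0.
have [t0|t0] := leP t 0.
  rewrite gamma_density0// addr_ge0//.
    by apply: restrict_ge0 => x _; exact: powR_ge0.
  by rewrite mulr_ge0// ?mulr_ge0 ?powR_ge0// exponential_pdf_ge0// ltW.
rewrite gamma_densityE// exponential_pdfE ?(ltW t0)// patchE; case: ifPn => [_|].
  rewrite ler_wpDr//; last by rewrite ger_pMr ?powR_gt0// -expR0 ler_expR oppr_le0 (ltW t0).
  by rewrite !mulr_ge0 ?powR_ge0 ?expR_ge0.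
rewrite notin_setE/= in_itv/= t0/= => /negP; rewrite -leNgt => t1.
rewrite (_ : point = 0)// add0r (_ : _ * (_ * _) = (2 * q) `^ q * expR (- 2^-1 * t)); last by field.
have -> : expR (- t) = expR (- 2^-1 * t) * expR (- 2^-1 * t).
  by rewrite -expRD; congr expR; field.
rewrite mulrA ler_wpM2r ?expR_ge0//.
rewrite mulNr expRN ler_pdivrMr ?expR_gt0//.
apply: (@le_trans _ _ (t `^ q)).
  apply: ler_powR => //; rewrite /q; have := ler_norm a; lra.
have -> : expR (2^-1 * t) = expR (t / (2 * q)) `^ q.
  by rewrite -expRM; congr expR; field; exact: lt0r_neq0.
have q2 : 0 <= 2 * q by rewrite mulr_ge0 ?(ltW q0).
rewrite -powRM ?expR_ge0//.
apply: ge0_ler_powR; rewrite ?nnegrE; try solve [exact: ltW | by rewrite mulr_ge0 ?expR_ge0].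
rewrite -ler_pdivrMl ?mulr_gt0// mulrC.
by have := expR_ge1Dx (t / (2 * q)); lra.
Qed.

Lemma gamma_density_lty a : 0 < a -> (\int[mu]_t (gamma_density a t)%:E < +oo)%E.
Proof.
move=> a0; have [C C0 leC] := gamma_density_le a.
pose g := (fun x : R => x `^ (a - 1)) \_ `]0, 1[.
have mg : measurable_fun [set: R] g.
  by apply/measurable_restrict => //; apply: measurable_funTS; exact: measurable_powR.
have g0 x : 0 <= g x by apply: restrict_ge0 => {}x _; exact: powR_ge0.
have e0 x : 0 <= exponential_pdf (2^-1 : R) x by exact: exponential_pdf_ge0.
have me := @measurable_exponential_pdf R 2^-1.
apply: (@le_lt_trans _ _ (\int[mu]_t ((g t)%:E + C%:E * (exponential_pdf 2^-1 t)%:E))%E).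
  apply: ge0_le_integral => //=.
  - by move=> x _; rewrite lee_fin gamma_density_ge0.
  - by apply/measurable_EFinP; exact: measurable_gamma_density.
  - apply: emeasurable_funD; first exact/measurable_EFinP.
    by apply: emeasurable_funM => //; exact/measurable_EFinP.
  - by move=> x _; rewrite -EFinM -EFinD lee_fin.
rewrite ge0_integralD//=; last 4 first.
- by move=> x _; rewrite lee_fin.
- exact/measurable_EFinP.
- by move=> x _; rewrite mule_ge0 ?lee_fin.
- by apply: emeasurable_funM => //; exact/measurable_EFinP.
rewrite ge0_integralZl//=; last 2 first.
- exact/measurable_EFinP.
- by move=> x _; rewrite lee_fin.
rewrite integral_exponential_pdf// mule1.
have -> : (\int[mu]_x (g x)%:E)%E = (a^-1)%:E.
  rewrite -integral_powR01// [RHS]integral_mkcond.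
  by apply: eq_integral => x _; rewrite restrict_EFin.
by rewrite -EFinD ltry.
Qed.

Lemma gamma_density_integral a : 0 < a ->
  (\int[mu]_t (gamma_density a t)%:E = (Gamma a)%:E)%E.
Proof.
move=> a0; rewrite GammaE fineK// ge0_fin_numE ?gamma_density_lty//.
by apply: integral_ge0 => t _; rewrite lee_fin gamma_density_ge0.
Qed.

(** On [1, 2] the density is at least the positive constant c, whatever the sign of a - 1. *)
Lemma Gamma_gt0 a : 0 < a -> 0 < Gamma a.
Proof.
move=> a0; rewrite -lte_fin -gamma_density_integral//.
pose c : R := expR (- 2) * 2 `^ (- `|a - 1|).
have c0 : 0 < c by rewrite mulr_gt0 ?expR_gt0 ?powR_gt0.
apply: (@lt_le_trans _ _ (\int[mu]_(t in `[1%R, 2%R]) (cst c%:E t))%E).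
  rewrite integral_cst//= lebesgue_measure_itv/= lte_fin ltr1n -EFinB -EFinM lte_fin.
  by rewrite mulr_gt0// subr_gt0 ltr1n.
rewrite integral_mkcond/=; apply: ge0_le_integral => //.
- by move=> t _; apply: erestrict_ge0 => x _; rewrite lee_fin ltW.
- exact/(measurable_restrictT _ _).1.
- by apply/measurable_EFinP; exact: measurable_gamma_density.
move=> t _; rewrite patchE; case: ifPn => [|_]; last by rewrite lee_fin gamma_density_ge0.
rewrite inE/= in_itv/= => /andP[t1 t2]; have t0 : 0 < t by lra.
rewrite lee_fin gamma_densityE// /c [leRHS]mulrC ler_pM ?powR_ge0 ?expR_ge0//.
  by rewrite ler_expR lerN2.
apply: (@le_trans _ _ (t `^ (- `|a - 1|))); last first.
    by apply: ler_powR => //; rewrite lerNl -normrN ler_norm.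
  rewrite !powRN lef_pV2 ?posrE ?powR_gt0//.
  by apply: ge0_ler_powR; rewrite ?nnegrE// ltW.

Qed.

Lemma Gamma1 : Gamma 1 = 1 :> R.
Proof.
apply: EFin_inj; rewrite -[LHS](gamma_density_integral ltr01).
have me : measurable_fun setT (fun x : R => (1 * expR (- 1 * x))%:E).
  by apply/measurable_EFinP/measurable_funM => //; apply: measurableT_comp => //; apply: measurable_funM.
transitivity (\int[mu]_x (exponential_pdf 1 x)%:E)%E; last exact: integral_exponential_pdf.
transitivity (\int[mu]_(t in `]0%R, +oo[) (1 * expR (- 1 * t))%:E)%E.
  rewrite [RHS]integral_mkcond; apply: eq_integral => t _.
  by rewrite /gamma_density !patchE; case: ifPn => // _; rewrite subrr powRr0 mulN1r.
rewrite integral_itv_obnd_cbnd; last exact: measurable_funTS.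
by rewrite integral_mkcond; apply: eq_integral => t _; rewrite restrict_EFin.
Qed.

End gamma_density.

Section beta_integral.
Context {R : realType}.
Notation mu := (@lebesgue_measure R).
Implicit Types a b s t z : R.

Definition beta_kernel a b t := t `^ (a - 1) * (1 - t) `^ (b - 1).

Lemma measurable_beta_kernel a b : measurable_fun [set: R] (beta_kernel a b).
Proof.
apply: measurable_funM; first exact: measurable_powR.
by apply: (measurableT_comp (measurable_powR _)) => //; exact: measurable_funB.
Qed.

Lemma beta_kernel_ge0 a b t : 0 <= beta_kernel a b t.
Proof. by rewrite mulr_ge0 ?powR_ge0. Qed.

Definition beta_integral a b := (\int[mu]_(t in `]0%R, 1%R[) (beta_kernel a b t)%:E)%E.

Lemma beta_integral_ge0 a b : (0 <= beta_integral a b)%E.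
Proof. by apply: integral_ge0 => t _; rewrite lee_fin beta_kernel_ge0. Qed.

(** The substitution y = x + (z - x) t. It serves the convolution below (x = 0) and the fractional
    integrals of powers of 1 - x (z = 1). *)
Lemma integral_beta_itv a b x z : x < z ->
  (\int[mu]_(y in `]x, z[) ((y - x) `^ (a - 1) * (z - y) `^ (b - 1))%:E =
   ((z - x) `^ (a + b - 1))%:E * beta_integral a b)%E.
Proof.
move=> xz; have c0 : 0 < z - x by rewrite subr_gt0.
have mf : measurable_fun [set: R] (fun y => ((y - x) `^ (a - 1) * (z - y) `^ (b - 1))).
  by apply: measurable_funM; apply: (measurableT_comp (measurable_powR _)) => //; exact: measurable_funB.
rewrite integral_mkcond (@ge0_integral_affine R (z - x) x)//; last 2 first.
- apply/(measurable_restrictT _ _).1 => //; apply: measurable_funTS; exact/measurable_EFinP.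
- by move=> y; apply: erestrict_ge0 => ? _; rewrite lee_fin mulr_ge0 ?powR_ge0.
have -> : a + b - 1 = 1 + ((a - 1) + (b - 1)) by ring.
rewrite powRD; last by rewrite (gt_eqF c0) implybT.
rewrite powRr1 ?(ltW c0)// EFinM -muleA; congr (_ * _)%E.
rewrite /beta_integral -ge0_integralZl//=; last 3 first.
- by apply/measurable_EFinP/measurable_funTS; exact: measurable_beta_kernel.
- by move=> t _; rewrite lee_fin beta_kernel_ge0.
- by rewrite lee_fin powR_ge0.
rewrite [RHS]integral_mkcond; apply: eq_integral => t _.
rewrite !patchE !mem_setE !in_itv/= ltrDr pmulr_rgt0// -ltrBrDr gtr_pMr//.
case: ifPn => // /andP[t0 t1].
rewrite -EFinM addrK (_ : z - ((z - x) * t + x) = (z - x) * (1 - t)); last by ring.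
rewrite !powRM ?(ltW c0) ?(ltW t0) ?subr_ge0 ?(ltW t1)//.
rewrite (@powRD _ _ (a - 1) (b - 1)); last by rewrite (gt_eqF c0) implybT.
by rewrite /beta_kernel mulrACA.
Qed.

(** The exponentials combine to expR (- r), which leaves a beta integral over ]0, r[; for r <= 0 the
    supports are disjoint. *)
Lemma gamma_density_conv a b r :
  (\int[mu]_t (gamma_density a t * gamma_density b (r - t))%:E =
   (gamma_density (a + b) r)%:E * beta_integral a b)%E.
Proof.
have [r0|r0] := leP r 0.
  rewrite gamma_density0// mul0e integral0_eq// => t _.
  have [t0|t0] := leP t 0; first by rewrite gamma_density0// mul0r.
  by rewrite [gamma_density b _]gamma_density0 ?mulr0//; lra.
rewrite gamma_densityE// mulrC EFinM -muleA.
have /esym := @integral_beta_itv a b 0 r r0; rewrite subr0 => ->.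
rewrite -ge0_integralZl//=; last 2 first.
- apply/measurable_EFinP/measurable_funTS.
  by apply: measurable_funM; apply: (measurableT_comp (measurable_powR _)) => //; exact: measurable_funB.
- by move=> t _; rewrite lee_fin mulr_ge0 ?powR_ge0.
rewrite [RHS]integral_mkcond; apply: eq_integral => t _.
rewrite patchE mem_setE in_itv/=; case: ifPn => [/andP[t0 tr]|].
  rewrite !gamma_densityE ?subr_gt0// subr0 -EFinM; congr EFin.
  have -> : expR (- r) = expR (- t) * expR (- (r - t)) by rewrite -expRD; congr expR; ring.
  by ring.
rewrite negb_and -!leNgt => /orP[t0|rt]; first by rewrite gamma_density0// mul0r.
by rewrite [gamma_density b _]gamma_density0 ?mulr0//; lra.
Qed.

(** Tonelli's theorem: the double integral of the densities at t and r - t is Gamma a * Gamma b in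
    one order and the integral of a convolution in the other. The multiplicative form makes sense
    before the beta integral is known to be finite. *)
Lemma Gamma_beta_integral a b : 0 < a -> 0 < b ->
  ((Gamma a * Gamma b)%:E = (Gamma (a + b))%:E * beta_integral a b)%E.
Proof.
move=> a0 b0; have ab0 : 0 < a + b by rewrite addr_gt0.
have mg c := @measurable_gamma_density R c.
have meg c : measurable_fun [set: R] (EFin \o gamma_density c) by exact/measurable_EFinP.
have g0 c := @gamma_density_ge0 R c.
have g0e (c x : R) : (0 <= (gamma_density c x)%:E)%E by rewrite lee_fin.
transitivity (\int[mu]_t \int[mu]_r (gamma_density a t * gamma_density b (r - t))%:E)%E.
  transitivity (\int[mu]_t ((gamma_density a t)%:E * (Gamma b)%:E))%E.
    rewrite ge0_integralZr//; first by rewrite gamma_density_integral.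
      exact: meg.
    by rewrite lee_fin ltW// Gamma_gt0.
  apply: eq_integral => t _.
  rewrite -(gamma_density_integral b0) (@ge0_integral_affine R 1 (- t) (EFin \o gamma_density b))//; last exact: g0e.
  rewrite mul1e.
  transitivity (\int[mu]_r ((gamma_density a t)%:E * (gamma_density b (r - t))%:E))%E; last first.
    by apply: eq_integral => r _; rewrite EFinM.
  have mgt : measurable_fun [set: R] (fun r => (gamma_density b (r - t))%:E).
    apply/measurable_EFinP; apply: (measurableT_comp (mg b)).
    exact: measurable_funB.
  rewrite [RHS]ge0_integralZl; [|exact: measurableT|exact: mgt|by move=> *; exact: g0e|exact: g0e].
  by congr (_ * _)%E; apply: eq_integral => r _; rewrite /= mul1r.
have := @fubini_tonelli _ _ _ _ _ mu mu (fun tr => (gamma_density a tr.1 * gamma_density b (tr.2 - tr.1))%:E).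
move=> /= -> //; last 2 first.
- apply/measurable_EFinP/measurable_funM.
    exact: (measurableT_comp (mg a)).
  by apply: (measurableT_comp (mg b)); apply: measurable_funB.
- by move=> x; rewrite lee_fin mulr_ge0.
under eq_integral do rewrite gamma_density_conv.
rewrite ge0_integralZr; [|exact: measurableT|exact: meg|by move=> *; exact: g0e|exact: beta_integral_ge0].
by rewrite gamma_density_integral.
Qed.

Lemma beta_integralE a b : 0 < a -> 0 < b ->
  beta_integral a b = (Gamma a * Gamma b / Gamma (a + b))%:E.
Proof.
move=> a0 b0; have G0 := Gamma_gt0 (addr_gt0 a0 b0).
by rewrite EFinM Gamma_beta_integral// muleAC -EFinM divff ?mul1e ?lt0r_neq0.
Qed.

(** Compare two evaluations of the beta integral at b = 1. *)
Lemma GammaS a : 0 < a -> Gamma (a + 1) = a * Gamma a.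
Proof.
move=> a0; have := Gamma_beta_integral a0 (@ltr01 R).
have -> : beta_integral a 1 = (a^-1)%:E.
  rewrite -integral_powR01//; apply: eq_integral => t _; congr EFin.
  by rewrite /beta_kernel subrr powRr0 mulr1.
rewrite -EFinM => -[]; rewrite Gamma1 mulr1 => ->.
by field; exact: lt0r_neq0.
Qed.

Lemma Gamma_nat n : Gamma n.+1%:R = n`!%:R :> R.
Proof.
elim: n => [|n IHn]; first by rewrite Gamma1.
by rewrite -[in LHS]natr1 GammaS// IHn factS natrM.
Qed.
End beta_integral.

(** * Absolutely continuous functions are integrals *)

Section stieltjes.
Context {R : realType}.
Notation mu := (@lebesgue_measure R).
Implicit Types (G : cumulative R R) (a b x e : R).

Lemma stieltjes_itvoc G a b : a <= b ->
  lebesgue_stieltjes_measure G `]a, b]%classic = (G b - G a)%:E.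
Proof.
move=> ab; rewrite /lebesgue_stieltjes_measure/= /measure_extension.
by rewrite measurable_mu_extE/= ?wlength_itv_bnd//; exact: is_ocitv.
Qed.

Lemma stieltjes_set1 G x : {for x, continuous G} ->
  lebesgue_stieltjes_measure G [set x] = 0%E.
Proof.
move=> cG; apply/eqP; rewrite eq_le measure_ge0 andbT.
apply/lee_addgt0Pr => e e0; rewrite add0e.
have [d d0 Gd] : exists2 d : R, 0 < d & G x - G (x - d) <= e.
  move/cvgrPdist_le : cG => /(_ e e0)[d /= d0 dG].
  exists (d / 2); first by rewrite divr_gt0.
  apply: le_trans (ler_norm _) _; apply: dG => /=.
  rewrite opprB addrC subrK gtr0_norm ?divr_gt0//.
  by rewrite ltr_pdivrMr// ltr_pMr// ltr1n.
apply: (@le_trans _ _ (lebesgue_stieltjes_measure G `]x - d, x]%classic)).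
  apply: le_measure; rewrite ?inE//.
  by move=> y /= ->; rewrite in_itv/= lexx andbT ltrBlDr ltrDl.
by rewrite stieltjes_itvoc ?lee_fin// gerBl ltW.
Qed.

Lemma stieltjes_itvoo G a b : a <= b -> {for b, continuous G} ->
  lebesgue_stieltjes_measure G `]a, b[%classic = (G b - G a)%:E.
Proof.
move=> ab cG; move: (ab); rewrite le_eqVlt => /predU1P[->|ab'].
  by rewrite set_itv_ge ?measure0 ?subrr// bnd_simp ltxx.
have := @stieltjes_itvoc G a b ab; rewrite -(@setUitv1 _ _ (BRight a) b true) ?bnd_simp//=.
rewrite measureU//=; first by rewrite stieltjes_set1// adde0.
apply/seteqP; split => // x [/=]; rewrite in_itv/= => /andP[_ xb] xb'.
  by move: xb; rewrite xb' ltxx.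
Qed.

(** Cover A by half-open intervals at a cost of e/2, then extend the n-th one to the right, by right
    continuity of G, at a cost of e / 2^(n+2). *)
Lemma stieltjes_outer_regular G (A : set R) e : measurable A ->
  (lebesgue_stieltjes_measure G A < +oo)%E -> 0 < e ->
  exists U : set R, [/\ open U, A `<=` U &
    (lebesgue_stieltjes_measure G U < lebesgue_stieltjes_measure G A + e%:E)%E].
Proof.
set m := lebesgue_stieltjes_measure G => mA Afin e0.
have e20 : 0 < e / 2 by rewrite divr_gt0.
have /ereal_inf_lt[z [/= M covM sMz zDe]] : (m A < m A + (e / 2)%:E)%E.
  by rewrite lte_spaddre ?lte_fin// ge0_fin_numE.
pose e2 n := e / 2 / (2 ^ n.+1)%:R.
have e2pos n : 0 < e2 n by rewrite ?divr_gt0.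
have mM n : ocitv (M n) by case: covM => /(_ n).
have mMn n : m (M n) = wlength G (M n).
  by rewrite /m /lebesgue_stieltjes_measure/= /measure_extension measurable_mu_extE//; exact: mM.
have /choice[V HV] : forall n, exists V : set R,
    [/\ open V, M n `<=` V & (m V <= m (M n) + (e2 n)%:E)%E].
  move=> n; have /ocitvP[->|[[a b /= ab ->]]] := mM n.
    by exists set0; split => //; rewrite leeDl// lee_fin ltW.
  have [d Gd] := nondecreasing_right_continuousP b G (e2pos n).
  exists `]a, b + d%:num[%classic; split; first exact: interval_open.
    by apply: subset_itvl; rewrite bnd_simp ltrDl.
  have abd : a <= b + d%:num by rewrite ler_wpDr// ltW.
  apply: (@le_trans _ _ (m `]a, b + d%:num]%classic)).
    apply: le_measure; rewrite ?inE//.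
    by apply: subset_itvl; rewrite bnd_simp.
  by rewrite /m !stieltjes_itvoc ?(ltW ab)// -EFinD lee_fin; lra.
exists (\bigcup_n V n); split.
- by apply: bigcup_open => n _; have [] := HV n.
- case: covM => _ /subset_trans; apply; apply: subset_bigcup => n _.
  by have [] := HV n.
have mV n : measurable (V n) by apply: open_measurable; have [] := HV n.
apply: (@le_lt_trans _ _ (\sum_(n <oo) m (V n))%E).
  exact: outer_measure_sigma_subadditive.
apply: (@le_lt_trans _ _ (\sum_(n <oo) (m (M n) + (e2 n)%:E))%E).
  by apply: lee_nneseries => // n _; have [] := HV n.
apply: le_lt_trans.
  by apply: epsilon_trick => //; rewrite ltW.
rewrite {2}[e]splitr EFinD addeA lte_leD//.
by under eq_eseriesr do rewrite mMn; rewrite sMz.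
Qed.

End stieltjes.

Section ac_null.
Context {R : realType}.
Notation mu := (@lebesgue_measure R).
Notation stieltjes := lebesgue_stieltjes_measure.
Implicit Types (p q : cumulative R R) (a b x e : R) (I A : set R).

(** The endpoints are the infimum and supremum of I; an empty I is given the endpoints (a, a). *)
Lemma open_interval_itvoo I a b : a <= b -> open I -> is_interval I ->
  I `<=` `]a, b[ -> exists lr : R * R,
  [/\ a <= lr.1, lr.1 <= lr.2, lr.2 <= b & I = `]lr.1, lr.2[%classic].
Proof.
move=> ab oI iI Iab; have [I0|/set0P[x0 Ix0]] := eqVneq I set0.
  exists (a, a) => /=; split => //; rewrite I0 set_itv_ge ?bnd_simp ?ltxx//.
have lI : has_lbound I by exists a => x /Iab/=; rewrite in_itv/= => /andP[/ltW].
have uI : has_ubound I by exists b => x /Iab/=; rewrite in_itv/= => /andP[_ /ltW].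
have nI : I !=set0 by exists x0.
have nil : ~ I (inf I).
  move=> /oI[d /= d0 dI].
  have : I (inf I - d / 2).
    apply: dI => /=; rewrite opprB addrC subrK gtr0_norm ?divr_gt0//.
    by rewrite ltr_pdivrMr// ltr_pMr// ltr1n.
  move=> /(ge_inf lI); rewrite leNgt => /negP; apply.
  by rewrite ltrBlDr ltrDl divr_gt0.
have nis : ~ I (sup I).
  move=> /oI[d /= d0 dI].
  have : I (sup I + d / 2).
    apply: dI => /=; rewrite opprD addrA subrr add0r normrN gtr0_norm ?divr_gt0//.
    by rewrite ltr_pdivrMr// ltr_pMr// ltr1n.
  move=> /(ub_le_sup uI); rewrite leNgt => /negP; apply.
  by rewrite ltrDl divr_gt0.
exists (inf I, sup I); split => /=.
- by apply: lb_le_inf => // x /Iab/=; rewrite in_itv/= => /andP[/ltW].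
- by apply: le_trans (ge_inf lI Ix0) (ub_le_sup uI Ix0).
- by apply: ge_sup => // x /Iab/=; rewrite in_itv/= => /andP[_ /ltW].
- move/is_intervalP : iI => {1}->.
  by rewrite /Rhull asboolT// asboolF// asboolT// asboolF.
Qed.

(* An open set of small Lebesgue measure that approximates A for both p and q is
   a disjoint union of intervals of small total length; p \- q varies little
   over them, so the p- and q-measures of A are arbitrarily close. *)
Lemma stieltjes_ac_null p q a b A : a <= b -> continuous p -> continuous q ->
  abs_continuous a b (p \- q) -> measurable A -> A `<=` `]a, b[ ->
  mu A = 0%E -> stieltjes p A = stieltjes q A.
Proof.
move=> ab cp cq acf mA Aab A0.
have finAB (r : cumulative R R) B : measurable B -> B `<=` `]a, b[ ->
    stieltjes r B \is a fin_num.
  move=> mB Bab; rewrite ge0_fin_numE//.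
  apply: (@le_lt_trans _ _ (stieltjes r `]a, b]%classic)).
    apply: le_measure; rewrite ?inE//.
    by apply: subset_trans Bab _; apply: subset_itvl; rewrite bnd_simp.
  by rewrite stieltjes_itvoc// ltry.
have finU (r : cumulative R R) : (stieltjes r A < +oo)%E.
  by rewrite -ge0_fin_numE//; exact: finAB.
(* One [e] pays for outer regularity, the other for the difference of the two measures on the open
   set U. *)
suff H e : 0 < e -> `|fine (stieltjes p A) - fine (stieltjes q A)| <= e + e.
  rewrite -[LHS]fineK ?finAB// -[RHS]fineK ?finAB//; congr EFin.
  apply/eqP; rewrite -subr_eq0 -normr_le0; apply/ler_addgt0Pr => e e0.
  by rewrite add0r [e]splitr; apply: H; rewrite divr_gt0.
move=> e0; have [d d0 acd] := acf e e0.
have [U1 [oU1 AU1 U1d]] : exists U, [/\ open U, A `<=` U & (mu U < d%:E)%E].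
  have := @stieltjes_outer_regular R idfun A d mA.
  rewrite -/(@lebesgue_measure R) A0 add0e; apply => //; exact: ltry.
have [U2 [oU2 AU2 U2p]] := stieltjes_outer_regular mA (finU p) e0.
have [U3 [oU3 AU3 U3q]] := stieltjes_outer_regular mA (finU q) e0.
pose U := (U1 `&` U2) `&` (U3 `&` `]a, b[%classic).
have oU : open U by do 2?apply: openI => //; apply: openI => //; exact: interval_open.
have mU : measurable U by exact: open_measurable.
have AU : A `<=` U by move=> x Ax; split; split; [exact: AU1|exact: AU2|exact: AU3|exact: Aab].
have Uab : U `<=` `]a, b[ by move=> x [_ []].
have UU1 : U `<=` U1 by move=> x [[]].
have UU2 : U `<=` U2 by move=> x [[]].
have UU3 : U `<=` U3 by move=> x [_ []].

pose J := open_disjoint_itv oU.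
have UE : U = \bigcup_i J i by exact: open_disjoint_itv_bigcup.
have tJ : trivIset setT J by exact: open_disjoint_itv_trivIset.
have mJ i : measurable (J i) by apply: open_measurable; exact: open_disjoint_itv_open.
have JU i : J i `<=` U by rewrite [X in _ `<=` X]UE; exact: bigcup_sup.
have /choice[lr Hlr] : forall i, exists lr : R * R,
    [/\ a <= lr.1, lr.1 <= lr.2, lr.2 <= b & J i = `]lr.1, lr.2[%classic].
  move=> i; apply: open_interval_itvoo => //.
  - exact: open_disjoint_itv_open.
  - exact: open_disjoint_itv_is_interval.
  - exact: subset_trans (JU i) Uab.
have JE (r : cumulative R R) i : continuous r ->
    stieltjes r (J i) = (r (lr i).2 - r (lr i).1)%:E.
  by move=> cr; have [_ lri _ ->] := Hlr i; rewrite stieltjes_itvoo//; exact: cr.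
have cvgJ (r : cumulative R R) : continuous r ->
    \sum_(i < n) (r (lr i).2 - r (lr i).1) @[n --> \oo] --> fine (stieltjes r U).
  move=> cr; have : (\sum_(0 <= i < n) stieltjes r (J i))%E @[n --> \oo] --> stieltjes r (\bigcup_i J i).
    by apply: measure_semi_sigma_additive => //; rewrite -UE.
  rewrite -UE -[X in _ --> X -> _]fineK ?finAB//.
  have -> : (fun n => \sum_(0 <= i < n) stieltjes r (J i))%E =
      EFin \o (fun n => \sum_(i < n) (r (lr i).2 - r (lr i).1)).
    apply/funext => n /=; rewrite big_mkord -sumEFin.
    by apply: eq_bigr => i _; rewrite JE.
  by move=> /fine_cvgP[].
have tJn n : trivIset [set: 'I_n] (J \o @nat_of_ord n).
  by move=> i j _ _ ij; apply: ord_inj; exact: tJ.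
have sumd n : \sum_(i < n) ((lr i).2 - (lr i).1) < d.
  rewrite -lte_fin; apply: le_lt_trans U1d; rewrite -sumEFin.
  have -> : (\sum_(i < n) ((lr i).2 - (lr i).1)%:E)%E = mu (\big[setU/set0]_(i < n) J i).
    rewrite (@measure_bigsetU_ord _ _ _ mu n predT (fun i => J i)); [|by move=> i; exact: mJ|exact: tJn].
    by apply: eq_bigr => i _; rewrite -(JE idfun)// => x; exact: cvg_id.
  have m1 : measurable (\big[setU/set0]_(i < n) J i).
    by apply: bigsetU_measurable => i _; exact: mJ.
  have m2 : measurable U1 by exact: open_measurable.
  apply: le_measure; rewrite ?inE//.
  by apply: subset_trans UU1; rewrite UE; exact: bigsetU_bigcup.
(* [abs_continuous] speaks of finite families, so the estimate is made for partial sums and passed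
   to the limit in PQ. *)
have sume n : `|\sum_(i < n) (p (lr i).2 - p (lr i).1) - \sum_(i < n) (q (lr i).2 - q (lr i).1)| <= e.
  rewrite -sumrB; apply: le_trans (ler_norm_sum _ _ _) _.
  apply: ltW; apply: le_lt_trans (acd n (fun i => (lr i).1) (fun i => (lr i).2) _ _ (sumd n)).
  - by apply: ler_sum => i _ /=; rewrite (_ : p _ - _ - _ = p (lr i).2 - q (lr i).2 - (p (lr i).1 - q (lr i).1))//; ring.
  - by move=> i; have [] := Hlr i.
  - by move=> i j _ _; have [_ _ _ <-] := Hlr i; have [_ _ _ <-] := Hlr j; exact: tJn.
have PQ : `|fine (stieltjes p U) - fine (stieltjes q U)| <= e.
  have H : `|\sum_(i < n) (p (lr i).2 - p (lr i).1) - \sum_(i < n) (q (lr i).2 - q (lr i).1)|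
      @[n --> \oo] --> `|fine (stieltjes p U) - fine (stieltjes q U)|.
    by apply: cvg_norm; apply: cvgB; exact: cvgJ.
  apply: (cvgr_to_le H).
  by apply: nearW => n; exact: sume.
have AUe (r : cumulative R R) V : open V -> A `<=` V -> U `<=` V ->
    (stieltjes r V < stieltjes r A + e%:E)%E ->
    fine (stieltjes r A) <= fine (stieltjes r U) <= fine (stieltjes r A) + e.
  move=> oV AV UV VA; rewrite -!lee_fin EFinD !fineK ?finAB//.
  rewrite le_measure ?inE//=; apply: le_trans (ltW VA).
  by apply: le_measure; rewrite ?inE//; exact: open_measurable.
have /andP[p1 p2] := AUe p _ oU2 AU2 UU2 U2p.
have /andP[q1 q2] := AUe q _ oU3 AU3 UU3 U3q.
by move: PQ; rewrite !ler_norml; lra.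
Qed.
End ac_null.

Section ac_variation.
Context {R : realType}.
Notation mu := (@lebesgue_measure R).
Implicit Types (a b x e : R) (f g : R -> R).

Lemma abs_continuous_dist a b f e : abs_continuous a b f -> 0 < e ->
  exists2 d, 0 < d & forall x y, a <= x -> x <= y -> y <= b -> y - x < d ->
    `|f y - f x| < e.
Proof.
move=> acf e0; have [d d0 fd] := acf e e0; exists d => // x y ax xy yb xyd.
have := fd 1%N (fun=> x) (fun=> y); rewrite !big_ord1; apply => //.
by move=> i j _ _ _; rewrite !ord1.
Qed.

Lemma abs_continuous_continuous a b f : a < b -> abs_continuous a b f ->
  {within `[a, b], continuous f}.
Proof.
move=> ab acf; apply/subspace_continuousP => x /=; rewrite in_itv/= => /andP[ax xb].
apply/cvgrPdist_lt => e e0; have [d d0 fd] := abs_continuous_dist acf e0.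
rewrite near_withinE; exists d => //= y xyd; rewrite in_itv/= => /andP[ay yb].
have [xy|yx] := leP x y.
  by rewrite distrC fd//; apply: le_lt_trans xyd; rewrite distrC ler_norm.
by rewrite fd// ?(ltW yx)//; apply: le_lt_trans xyd; rewrite ler_norm.
Qed.

(** With delta chosen for epsilon = 1, the variation over an interval shorter than delta is at most
    1, and finitely many intervals of length delta / 2 cover [a, b]. *)
Lemma abs_continuous_bounded_variation a b f : a <= b -> abs_continuous a b f ->
  bounded_variation a b f.
Proof.
move=> ab acf; have [d d0 fd] := acf 1 ltr01.
have step c c' : a <= c -> c <= c' -> c' <= b -> c' - c < d ->
    bounded_variation c c' f.
  move=> ac cc' c'b cd; exists 1 => _ [s cs <-].
  have [ps /eqP ls] := cs; pose F := nth c' (c :: s).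
  have sF i j : (i <= j <= size s)%N -> F i <= F j.
    move=> /andP[ij js]; apply: (sorted_leq_nth le_trans le_refl) => //=.
    - by apply: sub_path ps => ? ? /ltW.
    - by rewrite inE/= ltnS (leq_trans ij).
  have Fc i : (i <= size s)%N -> c <= F i <= c'.
    move=> si; rewrite /F itv_partition_nth_ge//=.
    by rewrite itv_partition_nth_le.
  rewrite /variation big_mkord; apply/ltW/(fd _ (fun i => F i) (fun i => F i.+1)).
  - move=> i; split; [|by apply: sF; rewrite leqnSn/=|].
      by have /andP[+ _] := Fc i (ltnW (ltn_ord i)); exact: le_trans.
    by have /andP[_] := Fc i.+1 (ltn_ord i); move/le_trans; apply.
  - have tri (i j : 'I_(size s)) : (i < j)%N ->
      `]F i, F i.+1[%classic `&` `]F j, F j.+1[%classic = set0.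
      move=> ij; apply/seteqP; split => // z [/=]; rewrite !in_itv/=.
      move=> /andP[_ zi] /andP[jz _].
      have : F i.+1 <= F j by apply: sF; rewrite ij/= ltnW.
      by rewrite leNgt (lt_trans jz zi).
    apply/trivIsetP => i j _ _ ij; have [ltij|leji] := ltnP i j; first exact: tri.
    rewrite setIC; apply: tri; rewrite ltn_neqAle leji andbT.
    by apply: contra ij => /eqP ij; apply/eqP/ord_inj.
  - rewrite -(big_mkord predT (fun i => F i.+1 - F i)) telescope_sumr//.
    by rewrite /F (itv_partition_nth_size _ cs).
have d20 : 0 < d / 2 by rewrite divr_gt0.
have d2d : d / 2 < d by rewrite ltr_pdivrMr// ltr_pMr// ltr1n.
suff H n c : a <= c -> c <= b -> b - c <= n%:R * (d / 2) ->
    total_variation c b f \is a fin_num.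
  apply/bounded_variationP => //; apply: (H (Num.truncn ((b - a) / (d / 2))).+1) => //.
  by rewrite -ler_pdivrMr// ltW// truncnS_gt.
elim: n c => [|n IHn] c ac cb.
  rewrite mul0r subr_le0 => bc; have -> : c = b by apply/eqP; rewrite eq_le cb.
  by rewrite total_variationxx.
rewrite -natr1 mulrDl mul1r => bcn.
have [bc|cdb] := leP b (c + d / 2).
  by apply/bounded_variationP => //; apply: step => //; lra.
have cc' : c <= c + d / 2 by rewrite ler_wpDr// ltW.
rewrite (total_variationD f cc' (ltW cdb)) fin_numD; apply/andP; split.
  apply/bounded_variationP => //; apply: step => //; first exact: ltW.
  by rewrite addrAC subrr add0r.
apply: IHn => //; [exact: le_trans cc'|exact: ltW|lra].
Qed.

Lemma cumulative_extension a b f : a <= b -> {within `[a, b], continuous f} ->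
  {in `[a, b] &, {homo f : x y / x <= y}} ->
  exists p : cumulative R R, continuous p /\ {in `[a, b], p =1 f}.
Proof.
move=> ab cf ndf; pose clamp x := Num.max a (Num.min x b).
have clampab x : clamp x \in `[a, b].
  by rewrite in_itv/= /clamp le_max lexx/= ge_max ab ge_min lexx orbT.
have cc : continuous clamp.
  move=> x; apply: (@continuous_max _ _ (cst a) (fun x => Num.min x b)); first exact: cst_continuous.
  by apply: (@continuous_min _ _ id (cst b)); [exact: cvg_id|exact: cst_continuous].
have cp : continuous (f \o clamp).
  move=> x; have /subspace_continuousP/(_ (clamp x) (clampab x)) := cf.
  move=> H; apply: (cvg_comp clamp f _ H) => A/= [e e0 eA].
  have /cvgrPdist_lt/(_ e e0) := cc x; apply: filterS => y xy.
  by apply: eA => //=; exact: clampab.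
have nd : {homo (f \o clamp) : x y / x <= y}.
  move=> x y xy /=; apply: ndf => //; rewrite /clamp ge_max !le_max lexx/= ge_min !le_min.
  by rewrite !ge_min lexx xy !orbT.
pose p : cumulative R R := HB.pack (f \o clamp)
  (isCumulative.Build R _ R (f \o clamp) nd (right_continuousW cp)).
exists p; split => // x; rewrite in_itv/= => /andP[ax xb].
by rewrite /p/= /clamp (min_idPl xb) (max_idPr ax).
Qed.

End ac_variation.

Section ac_density.
Context {R : realType}.
Notation mu := (@lebesgue_measure R).
Implicit Types (a b x e : R) (f g : R -> R).

(* The density is the Radon-Nikodym derivative of the charge associated with the
   Jordan decomposition of f. *)
Lemma abs_continuous_density a b f : a < b -> abs_continuous a b f ->
  exists g, [/\ mu.-integrable setT (EFin \o g),
    {in `[a, b], forall x, f x = f a + \int[mu]_(t in `]a, x[) g t} &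
    g = derive1 f %[ae mu in `]a, b[%classic]].
Proof.
move=> ab acf; have ab' := ltW ab.
have BVf := abs_continuous_bounded_variation ab' acf.
have cf := abs_continuous_continuous ab acf.
have aab : a \in `[a, b] by rewrite in_itv/= lexx ab'.
pose V := fine \o total_variation a ^~ f.
have TVfin x y : a <= x -> x <= y -> y <= b -> total_variation x y f \is a fin_num.
  move=> ax xy yb; apply/bounded_variationP => //.
  by apply: (bounded_variationl xy yb); exact: (bounded_variationr ax (le_trans xy yb)).
have VD x y : x \in `[a, b] -> y \in `[a, b] -> x <= y -> `|f y - f x| <= V y - V x.
  rewrite !in_itv/= => /andP[ax xb] /andP[ay yb] xy.
  rewrite /V/= (total_variationD f ax xy) fineD ?TVfin// addrAC subrr add0r.
  by rewrite -lee_fin fineK ?TVfin//; exact: total_variation_ge.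
(* The Jordan decomposition f = V - (V - f); by VD both parts are nondecreasing. *)
have [p [cp pV]] : exists p : cumulative R R, continuous p /\ {in `[a, b], p =1 V}.
  apply: cumulative_extension => //; first exact: total_variation_continuous.
  by move=> x y xab yab xy; rewrite -subr_ge0; exact: le_trans (VD _ _ xab yab xy).
have [q [cq qV]] : exists q : cumulative R R, continuous q /\ {in `[a, b], q =1 V \- f}.
  apply: cumulative_extension => //.
    move=> x; apply: (@continuousB _ _ (subspace `[a, b])); last exact: cf.
    exact: total_variation_continuous.
  move=> x y xab yab xy; have := VD _ _ xab yab xy; have := ler_norm (f y - f x).
  by rewrite /=; lra.
have pqf : {in `[a, b], p \- q =1 f}.
  by move=> x xab /=; rewrite pV// qV//= opprB addrC subrK.
have acpq : abs_continuous a b (p \- q).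
  move=> e e0; have [d d0 H] := acf e e0; exists d => // N l r lr tlr lrd.
  rewrite (eq_bigr (fun i => `|f (r i) - f (l i)|)); first exact: H.
  move=> i _; have [ali lri rib] := lr i.
  by rewrite !pqf// in_itv/= ?(le_trans ali lri)// ali (le_trans lri rib).
(* Both measures are restricted to ]a, b[ to make them finite, so that their difference is a
   charge. *)
pose D : set (measurableTypeR R) := `]a, b[%classic.
have mD : (R.-ocitv.-measurable).-sigma.-measurable D by exact: measurable_itv.
have sD (r : cumulative R R) : continuous r -> (lebesgue_stieltjes_measure r D < +oo)%E.
  by move=> cr; rewrite stieltjes_itvoo// ?ltry//; exact: cr.
pose np : {finite_measure set (measurableTypeR R) -> \bar R} := mfrestr mD (sD p cp).
pose nq : {finite_measure set (measurableTypeR R) -> \bar R} := mfrestr mD (sD q cq).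
pose eta : {charge set (measurableTypeR R) -> \bar R} :=
  cadd (charge_of_finite_measure np) (copp (charge_of_finite_measure nq)).
have etaE A : eta A = (lebesgue_stieltjes_measure p (A `&` D) -
   lebesgue_stieltjes_measure q (A `&` D))%E by [].
have etamu : eta `<< mu.
  apply/null_content_dominatesP => A mA muA0; rewrite etaE.
  have mAD : measurable (A `&` D) by exact: measurableI.
  have AD0 : mu (A `&` D) = 0%E.
    by apply/eqP; rewrite eq_le measure_ge0 andbT -muA0 le_measure ?inE.
  have ADab : A `&` D `<=` `]a, b[ by move=> x [].
  rewrite (stieltjes_ac_null ab' cp cq acpq mAD ADab AD0).
  rewrite subee// ge0_fin_numE//; apply: le_lt_trans (sD q cq).
  by apply: le_measure; rewrite ?inE.
pose g := fine \o Radon_Nikodym eta mu.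
have gE : EFin \o g = Radon_Nikodym eta mu.
  by apply/funext => x; rewrite /g/= fineK// Radon_Nikodym_fin_num.
have ig : mu.-integrable setT (EFin \o g) by rewrite gE; exact: Radon_Nikodym_integrable.
have fE : {in `[a, b], forall x, f x = f a + \int[mu]_(t in `]a, x[) g t}.
  move=> x xab; move: (xab); rewrite in_itv/= => /andP[ax xb].
  rewrite -!pqf//= /Rintegral.
  have -> : (\int[mu]_(t in `]a, x[) (g t)%:E = eta `]a, x[%classic)%E.
    by rewrite (Radon_Nikodym_integral etamu)// -gE.
  rewrite etaE setIidl; last by apply: subset_itvl; rewrite bnd_simp.
  by rewrite (stieltjes_itvoo ax (cp x)) (stieltjes_itvoo ax (cq x))/=; lra.
exists g; split => //.
have igy y : mu.-integrable [set` Interval (BRight a) (BRight y)] (EFin \o g).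
  exact: integrableS ig.
have lg : locally_integrable [set: R] g.
  by apply: open_integrable_locally => //; exact: openT.
(* Lebesgue's differentiation theorem identifies the density with the derivative of f a.e. *)
have := FTC1 igy lg; apply: filterS; first exact: (ae_filter_ringOfSetsType mu).
move=> x Fx /=; rewrite in_itv/= => /andP[ax xb].
have [dF <-] := Fx ax.
pose F y := \int[mu]_(t in `]a, y]) g t.
rewrite !derive1E; transitivity ('D_1 (fun y => f a + F y) x).
  by rewrite (deriveD (derivable_cst _ _ _) dF) derive_cst add0r.
apply: near_eq_derive; near=> y.
have yab : y \in `]a, b[ by near: y; apply: near_in_itvoo; rewrite in_itv/= ax.
have yab' : y \in `[a, b] by move: yab; rewrite !in_itv/= => /andP[/ltW-> /ltW->].
rewrite (fE y yab').
by rewrite /F Rintegral_itv_bndo_bndc//; exact: integrableS ig.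
Unshelve. all: by end_near. Qed.
End ac_density.

(** * Fractional integrals *)

Section ae_eq_unmeasurable.
Context d (T : measurableType d) (R : realType) (mu : {measure set T -> \bar R}).
Implicit Types (D : set T).
Local Open Scope ereal_scope.

Lemma ge0_le_integralT (f g : T -> \bar R) :
  (forall x, 0 <= f x) -> (forall x, f x <= g x) ->
  \int[mu]_x f x <= \int[mu]_x g x.
Proof.
move=> f0 fg; rewrite !ge0_integralTE//; last by move=> x; exact: le_trans (fg x).
apply: ge_ereal_sup => _ [h /= hf <-]; apply: ereal_sup_ubound; exists h => // x.
exact: le_trans (fg x).
Qed.

(* Integrals of possibly nonmeasurable functions are suprema of integrals of
   simple functions, so that they are still monotone: sandwich f between
   g restricted outside of the null set and g set to +oo on the null set. *)
Lemma ge0_ae_eq_integral_meas D (f g : T -> \bar R) : measurable D ->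
  measurable_fun D g ->
  (forall x, D x -> 0 <= f x) -> (forall x, D x -> 0 <= g x) ->
  ae_eq mu D f g -> \int[mu]_(x in D) f x = \int[mu]_(x in D) g x.
Proof.
move=> mD mg f0 g0 [N [mN N0 fgN]].
rewrite [LHS]integral_mkcond [RHS]integral_mkcond.
have fgN' x : ~ N x -> (f \_ D) x = (g \_ D) x.
  move=> Nx; rewrite !patchE; case: ifPn => // /[!inE] Dx.
  by apply: contrapT => fg; apply: Nx; apply: fgN => /(_ Dx).
have F0 x : 0 <= (f \_ D) x by exact: erestrict_ge0.
have G0 x : 0 <= (g \_ D) x by exact: erestrict_ge0.
have mG : measurable_fun setT (g \_ D) by exact/(measurable_restrictT _ _).1.
apply/eqP; rewrite eq_le; apply/andP; split.
  pose h x := (g \_ D) x + (cst +oo \_ N) x.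
  have mh : measurable_fun setT (cst +oo \_ N : T -> \bar R).
    exact/(measurable_restrictT _ _).1.
  have h0 x : 0 <= (cst +oo \_ N : T -> \bar R) x.
    by apply: erestrict_ge0 => y _; rewrite /cst leey.
  apply: (@le_trans _ _ (\int[mu]_x h x)).
    apply: ge0_le_integralT => // x; have [Nx|Nx] := pselect (N x).
      rewrite /h [X in _ + X]patchE mem_set//= addey ?leey//.
      by rewrite gt_eqF// (lt_le_trans _ (G0 x))// ltNye.
    by rewrite fgN'// leeDl.
  rewrite ge0_integralD// -[X in _ + X]integral_mkcond.
  by rewrite integral_cst// N0 mule0 adde0.
apply: (@le_trans _ _ (\int[mu]_x ((g \_ D) \_ (~` N)) x)).
  by rewrite -[leRHS]integral_mkcond (ge0_negligible_integral mN)// setTD.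
apply: ge0_le_integralT => [x|x]; first exact: erestrict_ge0.
rewrite [leLHS]patchE; case: ifPn => [/[!inE] Nx|_]; last exact: F0.
by rewrite fgN'.
Qed.

(** Asymmetric on purpose: f stands for expressions with [derive1n], [caputo] or partial integrals,
    which are arbitrary on a null set, and g for a measurable representative. *)
Lemma ae_eq_integral_meas D (f g : T -> \bar R) : measurable D ->
  measurable_fun D g -> ae_eq mu D f g ->
  \int[mu]_(x in D) f x = \int[mu]_(x in D) g x.
Proof.
move=> mD mg /ae_eq_funeposneg[fgp fgn].
rewrite integralE [RHS]integralE; congr (_ - _).
- by apply: ge0_ae_eq_integral_meas => //; exact: measurable_funepos.
- by apply: ge0_ae_eq_integral_meas => //; exact: measurable_funeneg.
Qed.

Lemma ae_eq_Rintegral D (f g : T -> R) : measurable D ->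
  measurable_fun D g -> ae_eq mu D f g ->
  (\int[mu]_(x in D) f x = \int[mu]_(x in D) g x)%R.
Proof.
move=> mD mg fg; congr fine; apply: ae_eq_integral_meas => //.
  exact/measurable_EFinP.
exact: ae_eq_comp.
Qed.
End ae_eq_unmeasurable.

(** * The Fubini exchange for the fractional kernel *)

Section convolution_Fubini.
Context {R : realType}.
Notation mu := (@lebesgue_measure R).
Implicit Types (a x y z : R) (g psi : R -> R).
Notation D := (`]-1, 1[%classic : set R).

(** Truncated to z > 0, so that [pos_power a (x - y)] is the kernel of both fractional integrals on
    the whole plane, up to the factor 1 / Gamma a. *)
Definition pos_power a : R -> R := (fun z => z `^ (a - 1)) \_ `]0, +oo[.

Lemma measurable_pos_power a : measurable_fun [set: R] (pos_power a).
Proof.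
by apply/measurable_restrict => //; apply: measurable_funTS; exact: measurable_powR.
Qed.

Lemma pos_power_ge0 a z : 0 <= pos_power a z.
Proof. by apply: restrict_ge0 => x _; exact: powR_ge0. Qed.

(** Uniform in y, which makes the kernel times an integrable g(y) integrable in both variables. The
    trivial factor (1 - x)^(1 - 1) brings the integral to the form of [integral_beta_itv]. *)
Lemma integral_pos_power a y : 0 < a -> y \in `]-1, 1[ ->
  (\int[mu]_(x in D) (pos_power a (x - y))%:E <= (2 `^ a * fine (beta_integral a 1))%:E)%E.
Proof.
move=> a0; rewrite in_itv/= => /andP[y1 y2].
have : ((beta_integral a 1)%E \is a fin_num) by rewrite beta_integralE.
move=> /fineK B; rewrite EFinM B.
apply: (@le_trans _ _ (\int[mu]_(x in `]y, 1%R[) ((x - y) `^ (a - 1) * (1 - x) `^ (1 - 1))%:E)%E).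
  rewrite integral_mkcond [leRHS]integral_mkcond; apply: ge0_le_integralT => x.
    by apply: erestrict_ge0 => z _; rewrite lee_fin pos_power_ge0.
  rewrite !patchE; case: ifPn => [/[!inE]/=/[!in_itv]/= /andP[x1 x2]|_]; last first.
    by case: ifPn => // _; rewrite lee_fin mulr_ge0 ?powR_ge0.
  rewrite mem_setE in_itv/= x2 andbT /pos_power patchE mem_setE in_itv/= andbT subr_gt0.
  by case: ifPn => // _; rewrite lee_fin subrr powRr0 mulr1.
rewrite integral_beta_itv// addrK lee_pmul2r//; last first.
  by rewrite beta_integralE// lte_fin divr_gt0 ?mulr_gt0 ?Gamma_gt0// addr_gt0.
  by rewrite beta_integralE.
by rewrite lee_fin; apply: ge0_ler_powR; rewrite ?nnegrE; lra.
Qed.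

Lemma measurable_pos_power_shift a y :
  measurable_fun [set: R] (fun x => pos_power a (x - y)).
Proof.
by apply: (measurableT_comp (measurable_pos_power a)); exact: measurable_funB.
Qed.

Lemma integral_pos_power_mul a psi (M : R) y : 0 < a ->
  measurable_fun [set: R] psi -> (forall x, x \notin `]-1, 1[ -> psi x = 0) ->
  (forall x, `|psi x| <= M) -> y \in `]-1, 1[ ->
  (\int[mu]_x `|(pos_power a (x - y) * psi x)%:E| <=
    (2 `^ a * fine (beta_integral a 1) * M)%:E)%E.
Proof.
move=> a0 mpsi psi0 psiM yD.
have M0 : 0 <= M by apply: le_trans (psiM 0).
apply: (@le_trans _ _ (\int[mu]_x (((fun x => (pos_power a (x - y))%:E) \_ D) x * M%:E))%E).
  apply: ge0_le_integralT => // x; rewrite patchE mem_setE.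
  case: ifPn => xD; last by rewrite psi0// mulr0 abse0 mul0e.
  by rewrite -EFinM lee_fin normrM ger0_norm ?pos_power_ge0// ler_wpM2l ?pos_power_ge0.
rewrite ge0_integralZr//; last first.
  - by move=> x _; apply: erestrict_ge0 => z _; rewrite lee_fin pos_power_ge0.
  - apply/(measurable_restrictT _ _).1 => //.
    by apply/measurable_EFinP/measurable_funTS; exact: measurable_pos_power_shift.
rewrite -integral_mkcond EFinM lee_wpmul2r//.
exact: integral_pos_power.
Qed.

Lemma integrable_pos_power_mul a psi (M : R) y : 0 < a ->
  measurable_fun [set: R] psi -> (forall x, x \notin `]-1, 1[ -> psi x = 0) ->
  (forall x, `|psi x| <= M) -> y \in `]-1, 1[ ->
  mu.-integrable setT (EFin \o (fun x => pos_power a (x - y) * psi x)).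
Proof.
move=> a0 mpsi psi0 psiM yD; apply/integrableP; split.
  by apply/measurable_EFinP/measurable_funM => //; exact: measurable_pos_power_shift.
by apply: le_lt_trans (integral_pos_power_mul a0 mpsi psi0 psiM yD) _; rewrite ltry.
Qed.

(** Absolute convergence comes from the uniform bound on the kernel, with g integrable and psi
    bounded. The inner integral in y may diverge for x in a null set, where it takes a default
    value; the outer integral does not see it. *)
Lemma conv_Fubini a g psi (M : R) : 0 < a ->
  mu.-integrable setT (EFin \o g) -> (forall y, y \notin `]-1, 1[ -> g y = 0) ->
  measurable_fun [set: R] psi -> (forall x, x \notin `]-1, 1[ -> psi x = 0) ->
  (forall x, `|psi x| <= M) ->
  \int[mu]_x ((\int[mu]_y (g y * pos_power a (x - y))) * psi x) =
  \int[mu]_y (g y * \int[mu]_x (pos_power a (x - y) * psi x)).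
Proof.
move=> a0 ig g0 mpsi psi0 psiM.
have M0 : 0 <= M by apply: le_trans (psiM 0).
have mg : measurable_fun [set: R] g by apply/measurable_EFinP; exact: measurable_int ig.
pose k (z : R * R) := pos_power a (z.1 - z.2).
have mk : measurable_fun [set: R * R] k.
  by apply: (measurableT_comp (measurable_pos_power a)); exact: measurable_funB.
pose f (z : R * R) := (g z.2 * k z * psi z.1)%:E.
have mf : measurable_fun [set: R * R] f.
  apply/measurable_EFinP; apply: measurable_funM; last exact: measurableT_comp.
  by apply: measurable_funM => //; exact: measurableT_comp.
pose C := 2 `^ a * fine (beta_integral a 1).
have kpsi y (yD : y \in `]-1, 1[) := integral_pos_power_mul a0 mpsi psi0 psiM yD.
have ikpsi y (yD : y \in `]-1, 1[) := integrable_pos_power_mul a0 mpsi psi0 psiM yD.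
have fE y x : f (x, y) = ((g y)%:E * (pos_power a (x - y) * psi x)%:E)%E.
  by rewrite /f /k/= -EFinM mulrA.
have If : (mu \x mu)%E.-integrable setT f.
  apply/integrable21ltyP => //.
  apply: (@le_lt_trans _ _ (\int[mu]_y (`|(g y)%:E| * (C * M)%:E))%E).
    apply: ge0_le_integralT => [y|y]; first exact: integral_ge0.
    under eq_integral do rewrite fE abseM.
    have [yD|yD] := boolP (y \in `]-1, 1[); last first.
      by under eq_integral do rewrite g0// abse0 mul0e; rewrite integral0 mule_ge0// lee_fin mulr_ge0// mulr_ge0 ?powR_ge0// fine_ge0// beta_integral_ge0.
    rewrite ge0_integralZl//; last first.
      by apply: measurableT_comp => //; exact: measurable_int (ikpsi y yD).
    by rewrite lee_wpmul2l// kpsi.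
  have C0 : 0 <= C * M by rewrite mulr_ge0// mulr_ge0 ?powR_ge0// fine_ge0// beta_integral_ge0.
  rewrite ge0_integralZr//; last first.
    - by apply: measurableT_comp => //; exact/measurable_EFinP.
  have /integrableP[_ ig'] := ig.
  by rewrite muleC; apply: lte_mul_pinfty.
have FubE := Fubini If.
transitivity (fine (\int[mu]_x \int[mu]_y f (x, y))%E).
  congr fine; apply: ae_eq_integral_meas => //; first exact: measurable_fubini_F If.
  have := ae_integrable1 If; apply: filterS => x ifx _ /=.
  (* Where psi vanishes, integrability of the slice says nothing about g times the kernel, but both
     sides are zero. *)
  have [psix0|psix0] := eqVneq (psi x) 0.
    by rewrite psix0 mulr0 integral0_eq// => y _; rewrite /f/= psix0 mulr0.
  have gk : mu.-integrable setT (EFin \o (fun y => g y * pos_power a (x - y))).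
    have -> : EFin \o (fun y => g y * pos_power a (x - y)) = (fun y => f (x, y) * ((psi x)^-1)%:E)%E.
      by apply/funext => y /=; rewrite /f/= -EFinM mulfK.
    exact: integrableZr.
  rewrite -RintegralZr// /Rintegral fineK//.
  by apply: integrable_fin_num => //; under eq_fun do rewrite EFinM; exact: integrableZr.
rewrite FubE; congr fine; apply: eq_integral => y _.
have [yD|yD] := boolP (y \in `]-1, 1[); last first.
  by rewrite g0// mul0r integral0_eq// => x _; rewrite fE g0// mul0e.
under eq_integral do rewrite fE.
rewrite integralZl//; last exact: ikpsi.
rewrite EFinM /Rintegral fineK//; exact: integrable_fin_num (ikpsi _ _).
Qed.

End convolution_Fubini.

Section fracint.
Context {R : realType}.
Notation mu := (@lebesgue_measure R).
Implicit Types (a s x y : R) (f g psi : R -> R).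
Notation D := (`]-1, 1[%classic : set R).

Lemma fracintLE a g x : 0 < a -> x \in `]-1, 1[ ->
  fracintL a g x = (Gamma a)^-1 * \int[mu]_y ((g \_ D) y * pos_power a (x - y)).
Proof.
move=> a0; rewrite in_itv/= => /andP[x1 x2]; rewrite /fracintL gt_eqF//; congr (_ * _).
rewrite Rintegral_mkcond; apply: eq_Rintegral => y _.
rewrite /pos_power !patchE !mem_setE !in_itv/= andbT subr_gt0.
have [yx|xy] := ltP y x; last by rewrite andbF mulr0.
rewrite (lt_trans yx x2) !andbT; case: ifPn => [_|_]; last by rewrite mul0r.
by rewrite -powRN opprB.
Qed.

Lemma fracintRE a psi y : 0 < a -> y \in `]-1, 1[ ->
  fracintR a psi y = (Gamma a)^-1 * \int[mu]_x (pos_power a (x - y) * (psi \_ D) x).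
Proof.
move=> a0; rewrite in_itv/= => /andP[y1 y2]; rewrite /fracintR gt_eqF//; congr (_ * _).
rewrite Rintegral_mkcond; apply: eq_Rintegral => x _.
rewrite /pos_power !patchE !mem_setE !in_itv/= andbT subr_gt0.
have [yx|xy] := ltP y x; last by rewrite mul0r.
rewrite (lt_trans y1 yx) /=; case: ifPn => [_|_]; last by rewrite mulr0.
by rewrite -powRN opprB mulrC.
Qed.

(** Both operators have the kernel (x - y)^(a - 1) on y < x, integrated in one variable or the
    other, so they are adjoint. The case a = 1 yields ordinary integration by parts. *)
Lemma fracint_by_parts a g psi (M : R) : 0 < a ->
  mu.-integrable D (EFin \o g) -> measurable_fun D psi ->
  (forall x, x \in `]-1, 1[ -> `|psi x| <= M) ->
  \int[mu]_(x in D) (fracintL a g x * psi x) =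
  \int[mu]_(y in D) (g y * fracintR a psi y).
Proof.
move=> a0 ig mpsi psiM; have mD : measurable D by exact: measurable_itv.
have Ga := Gamma_gt0 a0.
have M0 : 0 <= M by apply: le_trans (psiM 0 _); rewrite // in_itv/= ltrN10 ltr01.
pose p := (fun x => (Gamma a)^-1 * psi x) \_ D.
have p0 x : x \notin `]-1, 1[ -> p x = 0 by move=> xD; rewrite /p patchE mem_setE (negbTE xD).
have pM x : `|p x| <= (Gamma a)^-1 * M.
  rewrite /p patchE mem_setE; case: ifPn => [xD|_]; last by rewrite normr0 mulr_ge0// invr_ge0 ltW.
  by rewrite normrM gtr0_norm ?invr_gt0// ler_wpM2l ?psiM// invr_ge0 ltW.
have mp : measurable_fun [set: R] p.
  by apply/measurable_restrict => //; rewrite setTI; exact: measurable_funM.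
have igD : mu.-integrable setT (EFin \o (g \_ D)).
  have := (integrable_mkcond _ _).1 ig; rewrite restrict_EFin; apply; exact: measurable_itv.
have g0 x : x \notin `]-1, 1[ -> (g \_ D) x = 0 by move=> xD; rewrite patchE mem_setE (negbTE xD).
transitivity (\int[mu]_x ((\int[mu]_y ((g \_ D) y * pos_power a (x - y))) * p x)).
  rewrite Rintegral_mkcond; apply: eq_Rintegral => x _.
  rewrite patchE mem_setE; case: ifPn => xD; last by rewrite p0// mulr0.
  by rewrite fracintLE// /p patchE mem_setE xD mulrCA mulrA.
rewrite (conv_Fubini a0 igD g0 mp p0 pM) [RHS]Rintegral_mkcond.
apply: eq_Rintegral => y _.
rewrite [RHS]patchE mem_setE; case: ifPn => yD; last by rewrite g0// mul0r.
rewrite patchE mem_setE yD fracintRE//; congr (_ * _).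
have pE x : p x = (Gamma a)^-1 * (psi \_ D) x.
  by rewrite /p !patchE; case: ifPn => // _; rewrite mulr0.
rewrite -RintegralZl//.
  by apply: eq_Rintegral => x _; rewrite pE mulrCA.
have mpsi' : measurable_fun [set: R] (psi \_ D) by apply/measurable_restrict => //; rewrite setTI.
apply: (@integrable_pos_power_mul _ a (psi \_ D) M) => //.
  by move=> x xD; rewrite patchE mem_setE (negbTE xD).
move=> x; rewrite patchE mem_setE; case: ifPn => [|_]; first exact: psiM.
by rewrite normr0.
Qed.

End fracint.

(** * Fractional integrals of powers of 1 - x *)

Section frac_power.
Context {R : realType}.
Notation mu := (@lebesgue_measure R).
Implicit Types (a s x y : R) (f g : R -> R).

(* Normalised so that I_{1-}^a maps frac_power s to frac_power (s + a). *)
Definition frac_power s x := (1 - x) `^ s / Gamma (s + 1).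

Lemma measurable_frac_power s : measurable_fun [set: R] (frac_power s).
Proof.
apply: measurable_funM => //; apply: (measurableT_comp (measurable_powR _)) => //.
exact: measurable_funB.
Qed.

Lemma frac_power_ge0 s x : 0 <= s -> 0 <= frac_power s x.
Proof.
move=> s0; rewrite /frac_power divr_ge0 ?powR_ge0// ltW// Gamma_gt0//; lra.
Qed.

Lemma frac_power_le s x : 0 <= s -> -1 <= x <= 1 -> frac_power s x <= frac_power s (-1).
Proof.
move=> s0 /andP[x1 x2]; have G0 : 0 < Gamma (s + 1) by apply: Gamma_gt0; lra.
by rewrite ler_pM2r ?invr_gt0//; apply: ge0_ler_powR; rewrite ?nnegrE//; lra.
Qed.

(** A beta integral with parameters a and s + 1; its factor Gamma (s + 1) cancels the normalisation
    of [frac_power]. *)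
Lemma integral_frac_power_kernel a s x : 0 < a -> 0 <= s -> x < 1 ->
  (\int[mu]_(y in `]x, 1%R[) (frac_power s y / (y - x) `^ (1 - a))%:E =
   (Gamma a * frac_power (s + a) x)%:E)%E.
Proof.
move=> a0 s0 x1; have s10 : 0 < s + 1 by lra.
have G0 := Gamma_gt0 s10.
transitivity (\int[mu]_(y in `]x, 1%R[) ((Gamma (s + 1))^-1%:E * ((y - x) `^ (a - 1) * (1 - y) `^ (s + 1 - 1))%:E))%E.
  apply: eq_integral => y _; rewrite -EFinM; congr EFin.
  rewrite /frac_power addrK -powRN opprB; ring.
rewrite ge0_integralZl//; last first.
- by rewrite lee_fin invr_ge0 ltW.
- by move=> y _; rewrite lee_fin mulr_ge0 ?powR_ge0.
- apply/measurable_EFinP/measurable_funTS.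
  by apply: measurable_funM; apply: (measurableT_comp (measurable_powR _)) => //; exact: measurable_funB.
rewrite integral_beta_itv// beta_integralE// -!EFinM; congr EFin.
rewrite /frac_power (_ : a + (s + 1) - 1 = s + a); last by ring.
rewrite (_ : a + (s + 1) = s + a + 1); last by ring.
have G1 : 0 < Gamma (s + a + 1) by apply: Gamma_gt0; lra.
have E (g h p q : R) : g != 0 -> g^-1 * (p * (q * g * h)) = q * (p * h).
  by move=> g0; field.
exact: (E _ _ _ _ (lt0r_neq0 G0)).
Qed.

Lemma integrable_frac_power_kernel a s x : 0 < a -> 0 <= s -> x < 1 ->
  mu.-integrable `]x, 1[ (EFin \o (fun y => frac_power s y / (y - x) `^ (1 - a))).
Proof.
move=> a0 s0 x1; apply/integrableP; split.
  apply/measurable_EFinP/measurable_funTS; apply: measurable_funM.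
    exact: measurable_frac_power.
  under eq_fun do rewrite -powRN.
  by apply: (measurableT_comp (measurable_powR _)) => //; exact: measurable_funB.
under eq_integral.
  move=> y _; rewrite /= ger0_norm; last by rewrite divr_ge0 ?powR_ge0// frac_power_ge0.
  over.
by rewrite integral_frac_power_kernel// ltry.
Qed.

(** (1 - x)^s times a polynomial in 1 - x. In this basis I_{1-}^a changes s and leaves the
    coefficients c alone. *)
Definition frac_poly (c : nat -> R) n s x := \sum_(j < n) c j * frac_power (j%:R + s) x.

Lemma measurable_frac_poly c n s : measurable_fun [set: R] (frac_poly c n s).
Proof.
apply: measurable_sum => j; apply: measurable_funM => //.
exact: measurable_frac_power.
Qed.

Lemma frac_poly_bounded c n s : 0 <= s -> exists M, forall x, -1 <= x <= 1 ->
  `|frac_poly c n s x| <= M.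
Proof.
move=> s0; exists (\sum_(j < n) `|c j| * frac_power (j%:R + s) (-1)) => x x1.
have js (j : nat) : 0 <= j%:R + s by rewrite addr_ge0.
apply: le_trans (ler_norm_sum _ _ _) _; apply: ler_sum => j _.
by rewrite normrM ler_wpM2l// ger0_norm ?frac_power_ge0// frac_power_le.
Qed.

Lemma frac_poly1 c n s : 0 < s -> frac_poly c n s 1 = 0.
Proof.
move=> s0; rewrite /frac_poly big1// => j _; rewrite /frac_power subrr powR0 ?mul0r ?mulr0//.
by rewrite gt_eqF// ltr_wpDl.
Qed.

Lemma fracintR_frac_poly c n a s x : 0 < a -> 0 <= s -> x <= 1 ->
  fracintR a (frac_poly c n s) x = frac_poly c n (s + a) x.
Proof.
move=> a0 s0; rewrite le_eqVlt => /predU1P[->|x1].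
  rewrite frac_poly1 ?ltr_wpDl// /fracintR gt_eqF// set_itv_ge ?bnd_simp ?ltxx//.
  by rewrite Rintegral_set0 mulr0.
have js (j : nat) : 0 <= j%:R + s by rewrite addr_ge0.
have Ga := Gamma_gt0 a0.
rewrite /fracintR gt_eqF//.
(* Integrability is carried through the induction, as [RintegralD] asks for it. *)
suff [_ ->] : mu.-integrable `]x, 1[ (EFin \o (fun y => frac_poly c n s y / (y - x) `^ (1 - a))) /\
   \int[mu]_(y in `]x, 1[) (frac_poly c n s y / (y - x) `^ (1 - a)) =
     Gamma a * frac_poly c n (s + a) x.
  by rewrite mulKf// gt_eqF.
elim: n => [|n [IHi IHn]].
  have -> : (fun y => frac_poly c 0 s y / (y - x) `^ (1 - a)) = cst 0.
    by apply/funext => y; rewrite /frac_poly big_ord0 mul0r.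
  split; first exact: integrable0.
  by rewrite /frac_poly big_ord0 mulr0 /Rintegral integral0.
have -> : (fun y => frac_poly c n.+1 s y / (y - x) `^ (1 - a)) = (fun y =>
    frac_poly c n s y / (y - x) `^ (1 - a) +
    c n * (frac_power (n%:R + s) y / (y - x) `^ (1 - a))).
  by apply/funext => y; rewrite /frac_poly big_ord_recr/= mulrDl -mulrA.
have i1 : mu.-integrable `]x, 1[ (EFin \o (fun y => c n * (frac_power (n%:R + s) y / (y - x) `^ (1 - a)))).
  by apply: (integrableZl _ (c n) (integrable_frac_power_kernel a0 (js n) x1)).
split.
  exact: (integrableD _ IHi i1).
rewrite RintegralD// IHn /frac_poly [in RHS]big_ord_recr/= mulrDr; congr (_ + _).
rewrite RintegralZl//; last exact: integrable_frac_power_kernel.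
have := integral_frac_power_kernel a0 (js n) x1; rewrite /Rintegral => ->.
by rewrite [RHS]mulrCA [n%:R + (s + a)]addrA.
Qed.

End frac_power.

(** * Riemann-Stieltjes integration by parts *)

Section RSint.
Context {R : realType}.
Notation mu := (@lebesgue_measure R).
Implicit Types (a b c x y : R) (f g h phi psi W : R -> R).

(** W stands for the total variation of h over [a, x]; leaving it free allows a correction by hand
    for the jumps of [endpoint_limits]. *)
Definition variation_dominated a b h W :=
  forall x y, a <= x -> x <= y -> y <= b -> `|h y - h x| <= W y - W x.

(** As h = W - (W - h) with both terms nondecreasing on [a, b]; [clamp] makes them monotone on the
    whole line. *)
Lemma variation_dominated_measurable a b h W : a <= b ->
  variation_dominated a b h W -> measurable_fun `[a, b] h.
Proof.
move=> ab hW; pose clamp x := Num.max a (Num.min x b).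
have cab x : a <= clamp x <= b by rewrite /clamp le_max lexx/= ge_max ab ge_min lexx orbT.
have cnd x y : x <= y -> clamp x <= clamp y.
  move=> xy; rewrite /clamp ge_max !le_max lexx/= ge_min !le_min.
  by rewrite !ge_min lexx xy !orbT.
apply: (eq_measurable_fun ((W \o clamp) \- ((W \- h) \o clamp))).
  move=> x; rewrite inE/= in_itv/= => /andP[ax xb].
  by rewrite /clamp (min_idPl xb) (max_idPr ax) opprB addrC subrK.
apply: measurable_funB; apply: nondecreasing_measurable => // x y xy /=.
all: have /andP[ax _] := cab x; have /andP[_ yb] := cab y.
  by rewrite -subr_ge0; apply: le_trans (hW _ _ ax (cnd _ _ xy) yb).
by have := le_trans (ler_norm _) (hW _ _ ax (cnd _ _ xy) yb); lra.
Qed.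

Lemma variation_dominated_bounded a b h W : variation_dominated a b h W ->
  exists B, forall x, a <= x <= b -> `|h x| <= B.
Proof.
move=> hW; exists (`|h a| + (W b - W a)) => x /andP[ax xb].
have := hW _ _ (lexx a) ax xb; have := le_trans (normr_ge0 _) (hW _ _ ax xb (lexx b)).
by have := ler_normD (h a) (h x - h a); rewrite addrC subrK; lra.
Qed.

Lemma bounded_integrable (D : set R) f B : measurable D -> (mu D < +oo)%E ->
  measurable_fun D f -> (forall x, D x -> `|f x| <= B) ->
  mu.-integrable D (EFin \o f).
Proof.
move=> mD Dfin mf fB; apply: measurable_bounded_integrable => //.
exists B; split; first exact: num_real.
by move=> M BM x Dx; apply: le_trans (fB x Dx) (ltW BM).
Qed.

Lemma normr_Rintegral_le x y f B : x <= y -> mu.-integrable `]x, y] (EFin \o f) ->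
  (forall t, x <= t <= y -> `|f t| <= B) ->
  `|\int[mu]_(t in `]x, y]) f t| <= B * (y - x).
Proof.
move=> xy if1 fB; apply: le_trans (le_normr_Rintegral _ if1) _ => //.
have -> : B * (y - x) = \int[mu]_(t in `]x, y]) B.
  rewrite Rintegral_cst//= lebesgue_measure_itv/= lte_fin.
  by case: ltgtP xy => // -> _; rewrite subrr.
have mf : measurable_fun `]x, y] f by apply/measurable_EFinP; exact: measurable_int if1.
apply: le_Rintegral => //.
- by apply: integrable_norm.
- apply: bounded_integrable (fun _ _ => lexx `|B|) => //=.
  by rewrite lebesgue_measure_itv/=; case: ifPn => // _; rewrite ltry.
- by move=> t; rewrite /= in_itv/= => /andP[xt ty]; apply: fB; rewrite (ltW xt).
Qed.

Section RSint_by_parts.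
Variables (a b : R) (h W psi : R -> R) (M : R).
Hypothesis ab : a <= b.
Hypothesis hW : variation_dominated a b h W.
Hypothesis mpsi : measurable_fun [set: R] psi.
Hypothesis psiM : forall x, a <= x <= b -> `|psi x| <= M.

Let phi x := \int[mu]_(t in `]x, b]) psi t.
(** The expected value of int_c^b phi dh: phi is a primitive of -psi that vanishes at b, so
    integration by parts leaves a boundary term at c only. *)
Let J c := \int[mu]_(t in `]c, b]) (h t * psi t) - h c * phi c.

Let sub c d : a <= c -> d <= b -> `]c, d]%classic `<=` `[a, b]%classic.
Proof.
move=> ac db x; rewrite /= !in_itv/= => /andP[cx xd].
by rewrite (le_trans ac (ltW cx)) (le_trans xd db).
Qed.

Let muoo c d : (mu `]c, d]%classic < +oo)%E.
Proof. by rewrite lebesgue_measure_itv/=; case: ifPn => // _; rewrite ltry. Qed.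

Let ipsi c d : a <= c -> d <= b -> mu.-integrable `]c, d] (EFin \o psi).
Proof.
move=> ac db; apply: (@bounded_integrable _ _ M) => //; first exact: measurable_funTS.
by move=> x /(sub ac db)/=; rewrite in_itv/=; exact: psiM.
Qed.

Let ihpsi (k : R) c d : a <= c -> d <= b ->
  mu.-integrable `]c, d] (EFin \o (fun t => (h t - k) * psi t)).
Proof.
move=> ac db; have [B hB] := variation_dominated_bounded hW.
apply: (@bounded_integrable _ _ ((B + `|k|) * M)) => //.
  apply: measurable_funM; last exact: measurable_funTS.
  apply: measurable_funB => //; apply: measurable_funS (variation_dominated_measurable ab hW) => //.
  exact: sub.
move=> x /(sub ac db)/=; rewrite in_itv/= => xab.
rewrite normrM ler_pM ?psiM//.
by apply: le_trans (ler_normB _ _) _; rewrite lerD2r hB.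
Qed.

Let M0 : 0 <= M. Proof. by apply: le_trans (psiM (x := a) _) => //; rewrite lexx ab. Qed.

Let split_itv f c d : mu.-integrable `]c, b] (EFin \o f) -> c <= d -> d <= b ->
  \int[mu]_(t in `]c, b]) f t = \int[mu]_(t in `]c, d]) f t + \int[mu]_(t in `]d, b]) f t.
Proof.
move=> if1 cd db; rewrite -(@Rintegral_itvB _ f (BRight c) (BRight b) d)//.
by rewrite addrC subrK.
Qed.

Let phiB c d : a <= c -> c <= d -> d <= b -> `|phi c - phi d| <= M * (d - c).
Proof.
move=> ac cd db; rewrite /phi (split_itv (ipsi ac (lexx b)) cd db) addrK.
apply: normr_Rintegral_le => //; first exact: ipsi.
by move=> t /andP[ct td]; apply: psiM; rewrite (le_trans ac ct) (le_trans td db).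
Qed.

(** Induction on the partition, with its left end c free. The first cell ]c, d] causes two errors,
    phi (t 0) against phi d and h against h c under the integral; each is at most (W d - W c) * M *
    delta, and the increments of W telescope. *)
Lemma RSint_sum_le (delta : R) s c (t : nat -> R) :
  let x := nth b (c :: s) in
  a <= c -> itv_partition c b s ->
  (forall i, (i < size s)%N -> x i.+1 - x i < delta /\ x i <= t i <= x i.+1) ->
  `|\sum_(i < size s) phi (t i) * (h (x i.+1) - h (x i)) - J c| <=
    2 * M * delta * (W b - W c).
Proof.
elim: s c t => [|d s IHs] c t /= ac.
  move=> /itv_partition_nil -> _; rewrite big_ord0 sub0r normrN /J /phi.
  by rewrite set_itv_ge ?bnd_simp ?ltxx// !Rintegral_set0 mulr0 !subrr normr0 mulr0.
move=> cs ht; have ds := itv_partition_cons cs.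
have cd : c < d by case: cs => /= /andP[].
have db : d <= b by exact: itv_partition_le ds.
have ad : a <= d := le_trans ac (ltW cd).
have {}IHs := IHs d (t \o S) ad ds (fun i si => ht i.+1 si).
have [/= cdd /andP[ct td]] := ht 0%N isT.
rewrite big_ord_recl /=.
set S := \sum_(i < _) _ in IHs *.
have hcd := hW ac (ltW cd) db.
have e1 : `|(h d - h c) * (phi (t 0%N) - phi d)| <= (W d - W c) * (M * delta).
  rewrite normrM ler_pM//; apply: le_trans (phiB (le_trans ac ct) td db) _.
  by rewrite ler_wpM2l//; lra.
have e2 : `|\int[mu]_(u in `]c, d]) ((h u - h c) * psi u)| <= (W d - W c) * (M * delta).
  apply: (@le_trans _ _ ((W d - W c) * M * (d - c))).
    apply: normr_Rintegral_le; [exact: ltW|exact: ihpsi|].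
    move=> u /andP[cu ud]; have ub := le_trans ud db.
    rewrite normrM ler_pM ?psiM ?(le_trans ac cu)//.
    apply: le_trans (hW ac cu ub) _; rewrite lerD2r -subr_ge0.
    exact: le_trans (normr_ge0 _) (hW (le_trans ac cu) ud db).
  by rewrite -mulrA ler_wpM2l ?(le_trans _ hcd)// ler_wpM2l// ltW.
have JE : J c = J d + \int[mu]_(u in `]c, d]) ((h u - h c) * psi u) + (h d - h c) * phi d.
  have ih0 c' d' : a <= c' -> d' <= b -> mu.-integrable `]c', d'] (EFin \o (fun t => h t * psi t)).
    move=> ac' db'; have -> : (fun t => h t * psi t) = (fun t => (h t - 0) * psi t).
      by apply/funext => u; rewrite subr0.
    exact: ihpsi.
  have -> : \int[mu]_(u in `]c, d]) ((h u - h c) * psi u) =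
      \int[mu]_(u in `]c, d]) (h u * psi u) - h c * \int[mu]_(u in `]c, d]) psi u.
    rewrite -RintegralZl//; last exact: ipsi.
    rewrite -RintegralB//; [|exact: ih0|by apply: (integrableZl _ (h c) (ipsi ac db))].
    by apply: eq_Rintegral => u _; rewrite mulrBl.
  rewrite /J (split_itv (ih0 _ _ ac (lexx b)) (ltW cd) db).
  rewrite /phi (split_itv (ipsi ac (lexx b)) (ltW cd) db); ring.
rewrite (_ : _ - J c = (h d - h c) * (phi (t 0%N) - phi d) -
   \int[mu]_(u in `]c, d]) ((h u - h c) * psi u) + (S - J d)); last by rewrite JE; ring.
apply: le_trans (ler_normD _ _) _.
have := ler_normB ((h d - h c) * (phi (t 0%N) - phi d)) (\int[mu]_(u in `]c, d]) ((h u - h c) * psi u)).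
rewrite (_ : 2 * M * delta * (W b - W c) = (W d - W c) * (M * delta) + (W d - W c) * (M * delta)
   + 2 * M * delta * (W b - W d)); last by ring.
by move=> e3; apply: lerD => //; apply: le_trans e3 _; exact: lerD.
Qed.

Lemma is_RSint_by_parts : is_RSint a b phi h (J a).
Proof.
have Wab : 0 <= W b - W a by exact: le_trans (normr_ge0 _) (hW (lexx a) ab (lexx b)).
(* The added 1 keeps K positive and the final inequality strict. *)
move=> e e0; pose K := 2 * M * (W b - W a) + 1.
have K0 : 0 < K by rewrite /K ltr_wpDl// !mulr_ge0.
exists (e / K); first by rewrite divr_gt0.
move=> s t x xs xt; apply: le_lt_trans (RSint_sum_le (lexx a) xs xt) _.
rewrite mulrAC mulrA ltr_pdivrMr// [ltRHS]mulrC ltr_pM2r// /K.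
by rewrite ltrDl.
Qed.
End RSint_by_parts.
End RSint.

(** * Legendre polynomials in powers of 1 - x *)

Section rising.
Context {R : realType}.
Implicit Types (a c r s : R) (n j : nat).

(** Pochhammer's symbol. It replaces Gamma (r + n) / Gamma r, including for r <= 0, where [Gamma] is
    meaningless. *)
Definition rising r n := \prod_(i < n) (r + i%:R).

Lemma rising0 r : rising r 0 = 1. Proof. by rewrite /rising big_ord0. Qed.

Lemma risingS r n : rising r n.+1 = rising r n * (r + n%:R).
Proof. by rewrite /rising big_ord_recr. Qed.

Lemma risingSl r n : rising r n.+1 = r * rising (r + 1) n.
Proof.
rewrite /rising big_ord_recl addr0; congr (_ * _); apply: eq_bigr => i _.
by rewrite lift0 -natr1; ring.
Qed.

Lemma rising_rev r n : rising (r - n%:R) n = (-1) ^+ n * rising (1 - r) n.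
Proof.
elim: n r => [|n IHn] r; first by rewrite !rising0 expr0 mulr1.
rewrite risingSl (_ : r - n.+1%:R + 1 = r - n%:R); last by rewrite -natr1; ring.
by rewrite IHn risingS exprS -natr1; ring.
Qed.

Lemma rising_nat m n : m`!%:R * rising m.+1%:R n = (m + n)`!%:R :> R.
Proof.
elim: n => [|n IHn]; first by rewrite rising0 mulr1 addn0.
by rewrite risingS mulrA IHn addnS factS natrM mulrC -natrD addSn.
Qed.

Lemma rising_eq0 i r n : (i < n)%N -> r + i%:R = 0 -> rising r n = 0.
Proof.
by move=> ni ri; rewrite /rising (bigD1 (Ordinal ni))//= ri mul0r.
Qed.

Lemma Gamma_rising r n : 0 < r -> Gamma (r + n%:R) = rising r n * Gamma r.
Proof.
move=> r0; elim: n => [|n IHn]; first by rewrite addr0 rising0 mul1r.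
have rn0 : 0 < r + n%:R by rewrite ltr_wpDr.
rewrite -natr1 addrA (GammaS rn0) IHn risingS mulrA; congr (_ * _); exact: mulrC.
Qed.

Lemma sum_binS (F : nat -> R) n :
  \sum_(j < n.+2) F j *+ 'C(n.+1, j) = \sum_(j < n.+1) (F j + F j.+1) *+ 'C(n, j).
Proof.
rewrite big_ord_recl bin0 mulr1n.
under eq_bigr do rewrite lift0 binS mulrnDr.
rewrite big_split/= big_ord_recr/= bin_small// mulr0n addr0.
under [RHS]eq_bigr do rewrite mulrnDl.
by rewrite [RHS]big_split/= [in RHS]big_ord_recl bin0 mulr1n -addrA.
Qed.

(** Induction on n with c free: after Pascal's rule ([sum_binS]), neighbouring terms combine with
    the factor (c + j) - (a + j) = c - a, leaving the sum for n and c + 1. *)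
Lemma rising_Vandermonde a c n :
  \sum_(j < n.+1) ((-1) ^+ j * rising a j * rising (c + j%:R) (n - j)) *+ 'C(n, j) =
  rising (c - a) n.
Proof.
elim: n c => [|n IHn] c.
  by rewrite big_ord1 !rising0 expr0 !mulr1.
rewrite (sum_binS (fun j => (-1) ^+ j * rising a j * rising (c + j%:R) (n.+1 - j))).
rewrite risingSl addrAC -IHn mulr_sumr; apply: eq_bigr => j _.
have jn : (j <= n)%N by rewrite -ltnS.
rewrite subSS subSn// risingSl (risingS a) exprS -natr1 mulrnAr; congr (_ *+ _).
rewrite (_ : c + (j%:R + 1) = c + 1 + j%:R) 1?(_ : c + j%:R + 1 = c + 1 + j%:R); by ring.
Qed.

End rising.

Section legendre_expansion.
Context {R : realType}.
Implicit Types (x r : R) (n j : nat).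

Lemma derivn_exp_1subX n m :
  derivn n ((1 - 'X) ^+ m : {poly R}) = ((-1) ^+ n * (m ^_ n)%:R) *: (1 - 'X) ^+ (m - n).
Proof.
elim: n => [|n IHn]; first by rewrite derivn0 ffactn0 expr0 mulr1 scale1r subn0.
rewrite derivnS IHn derivZ deriv_exp derivB derivX derivC sub0r subnS.
rewrite mulN1r mulNrn scalerN -scalerMnr scalerMnl -scaleNr; congr (_ *: _).
by rewrite ffactnSr natrM exprS -mulr_natr; ring.
Qed.

(** P_n(x) is the hypergeometric 2F1(-n, n+1; 1; (1-x)/2): one of its two factors 1/j! is in the
    binomial coefficient, the other in [frac_power]. *)
Definition legendre_bin n j : R :=
  (-1) ^+ j * rising n.+1%:R j *+ 'C(n, j) / 2 ^+ j.

(** Rodrigues' formula with X^2 - 1 = (1 - X)((1 - X) - 2), expanded by the binomial theorem and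
    differentiated term by term. For x <= 1 the real powers of 1 - x agree with the polynomial
    ones. *)
Lemma legendreE n x : x <= 1 ->
  (legendre R n).[x] = frac_poly (legendre_bin n) n.+1 0 x.
Proof.
move=> x1; have x1' : 0 <= 1 - x by rewrite subr_ge0.
rewrite /legendre.
have -> : ('X ^+ 2 - 1 : {poly R}) ^+ n =
    \sum_(j < n.+1) ((-2) ^+ (n - j) *+ 'C(n, j)) *: (1 - 'X) ^+ (n + j).
  have -> : ('X ^+ 2 - 1 : {poly R}) = (1 - 'X) * ((-2)%:P + (1 - 'X)).
    by rewrite -[(-2)%:P]/(polyC (- 2)) polyCN -[2]/(1 + 1 : R) polyCD; ring.
  rewrite exprMn [((-2)%:P + _) ^+ n]exprDn mulr_sumr; apply: eq_bigr => j _.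
  rewrite mulrnAr -scalerMnl; congr (_ *+ _).
  by rewrite -polyC_exp mul_polyC -scalerAr exprD.
rewrite linear_sum/= scaler_sumr horner_sum; apply: eq_bigr => j _.
have jn : (j <= n)%N by rewrite -ltnS.
rewrite derivnZ derivn_exp_1subX !hornerZ addKn.
rewrite horner_exp hornerD hornerN hornerX hornerC -!mulrA.
rewrite /legendre_bin /frac_power !addr0 natr1 Gamma_nat powR_mulrn//.
have En : rising n.+1%:R j = (n + j)`!%:R / n`!%:R :> R.
  by rewrite -rising_nat mulrC mulKf// pnatr_eq0 -lt0n fact_gt0.
have Ej : ((n + j) ^_ n)%:R = (n + j)`!%:R / j`!%:R :> R.
  rewrite -(ffact_fact (leq_addr j n)) addKn natrM mulfK//.
have s2 d i : (-2 : R) ^+ d * (-1) ^+ (d + i) * 2 ^+ i = (-1) ^+ i * 2 ^+ (d + i).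
  rewrite !exprD (exprNn 2).
  have : (-1 : R) ^+ d * (-1) ^+ d = 1 by rewrite -exprMn mulrNN mulr1 expr1n.
  set e := (-1) ^+ d => ee.
  transitivity (e * e * (2 ^+ d * (-1) ^+ i * 2 ^+ i)); first by ring.
  by rewrite ee; ring.
have {}s2 := s2 (n - j)%N j; rewrite subnK// in s2.
rewrite En Ej -[(-2) ^+ _ *+ _]mulr_natl -[_ * _ *+ _]mulr_natl.
have -> : (-1 : R) ^+ j = (-2) ^+ (n - j) * (-1) ^+ n * 2 ^+ j / 2 ^+ n.
  by rewrite s2 mulfK// expf_neq0// pnatr_eq0.
have f0 i : i`!%:R != 0 :> R by rewrite pnatr_eq0 -lt0n fact_gt0.
have t0 i : (2 : R) ^+ i != 0 by rewrite expf_neq0// pnatr_eq0.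
by field; rewrite !f0 !t0.
Qed.

(** The powers 2^j cancel. Over the common denominator Gamma (n + r + 1) the j-th term gains the
    factor [rising (r + 1 + j) (n - j)], and the sum is [rising_Vandermonde] with a = n + 1 and c =
    r + 1. *)
Lemma frac_poly_legendre_bin_N1 n r : 0 <= r ->
  frac_poly (legendre_bin n) n.+1 r (-1) =
  2 `^ r * rising (r - n%:R) n / Gamma (n%:R + r + 1).
Proof.
move=> r0; have -> : r - n%:R = (r + 1) - n.+1%:R by rewrite -natr1; ring.
rewrite -rising_Vandermonde mulr_sumr mulr_suml; apply: eq_bigr => j _.
have jr : 0 < j%:R + r + 1 by rewrite ltr_wpDl// addr_ge0.
rewrite /legendre_bin /frac_power opprK -[1 + 1]/(2%:R) powRD; last first.
  by rewrite pnatr_eq0 implybT.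
rewrite powR_mulrn//.
have -> : n%:R + r + 1 = (j%:R + r + 1) + (n - j)%:R.
  have jn : (j <= n)%N by rewrite -ltnS.
  by rewrite natrB//; ring.
have G0 := Gamma_gt0 jr.
have p0 : rising (j%:R + r + 1) (n - j) != 0.
  by rewrite gt_eqF// /rising prodr_gt0// => i _; rewrite ltr_wpDr.
rewrite Gamma_rising// (_ : r + 1 + j%:R = j%:R + r + 1); last by ring.
rewrite -[_ * rising _ _ *+ _]mulr_natl -[_ * _ * rising _ _ *+ _]mulr_natl; field.
by rewrite p0 (gt_eqF G0) expf_neq0// pnatr_eq0.
Qed.

End legendre_expansion.

(** * Euler's reflection formula *)

Section Gamma_log_convex.
Context {R : realType}.
Notation mu := (@lebesgue_measure R).
Implicit Types (a b c d e p q r t x y z : R).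

(** The exponential lies above its tangent at the mean point c. *)
Lemma expR_convex t a b : 0 <= t <= 1 ->
  expR (t * a + (1 - t) * b) <= t * expR a + (1 - t) * expR b.
Proof.
move=> /andP[t0 t1]; set c := t * a + (1 - t) * b.
have tangent z : expR c * (1 + (z - c)) <= expR z.
  have -> : expR z = expR c * expR (z - c) by rewrite -expRD addrC subrK.
  by rewrite ler_pM2l ?expR_gt0// expR_ge1Dx.
rewrite [leLHS](_ : _ = t * (expR c * (1 + (a - c))) + (1 - t) * (expR c * (1 + (b - c)))).
  by rewrite lerD// ler_wpM2l ?tangent// subr_ge0.
by rewrite /c; ring.
Qed.

(** The weighted inequality of means, scaled to be an equality at x = a, y = b. With expR a and expR
    b the integrals of expR x and expR y, integrating it gives Hoelder's inequality. *)
Lemma expR_mean t x y a b : 0 <= t <= 1 ->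
  expR (t * x + (1 - t) * y) <=
  expR (t * a + (1 - t) * b) * t / expR a * expR x +
  expR (t * a + (1 - t) * b) * (1 - t) / expR b * expR y.
Proof.
move=> t01; set C := expR (t * a + (1 - t) * b).
rewrite [leRHS](_ : _ = C * (t * expR (x - a) + (1 - t) * expR (y - b))).
  rewrite (_ : t * x + _ = t * a + (1 - t) * b + (t * (x - a) + (1 - t) * (y - b))).
    by rewrite [leLHS]expRD ler_pM2l ?expR_gt0// expR_convex.
  by ring.
by rewrite !expRD !expRN; ring.
Qed.

Lemma Gamma_le_comb c d r p q : 0 < r -> 0 < p -> 0 < q -> 0 <= c -> 0 <= d ->
  (forall t, gamma_density r t <= c * gamma_density p t + d * gamma_density q t) ->
  Gamma r <= c * Gamma p + d * Gamma q.
Proof.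
move=> r0 p0 q0 c0 d0 le.
have me a : measurable_fun setT (fun t : R => (gamma_density a t)%:E).
  by apply/measurable_EFinP; exact: measurable_gamma_density.
have g0 a t : (0 <= (gamma_density a t)%:E)%E by rewrite lee_fin gamma_density_ge0.
have mz e a : measurable_fun setT (fun t : R => (e%:E * (gamma_density a t)%:E)%E).
  by apply: emeasurable_funM; [exact: measurable_cst|exact: me].
have gz e a t : 0 <= e -> (0 <= e%:E * (gamma_density a t)%:E)%E.
  by move=> e0; rewrite mule_ge0.
have intZ e a : 0 < a -> 0 <= e ->
    (\int[mu]_t (e%:E * (gamma_density a t)%:E) = (e * Gamma a)%:E)%E.
  move=> a0 e0; rewrite EFinM -(gamma_density_integral a0).
  by apply: ge0_integralZl; [exact: measurableT|exact: me|move=> t _; exact: g0|].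
rewrite -lee_fin EFinD -!intZ// -(gamma_density_integral r0).
rewrite -ge0_integralD//; [| |exact: mz| |exact: mz].
- apply: ge0_le_integralT => t; first exact: g0.
  by rewrite -!EFinM -EFinD lee_fin.
- by move=> t _; exact: gz.
- by move=> t _; exact: gz.
Qed.

Lemma Gamma_log_convex z p q : 0 <= z <= 1 -> 0 < p -> 0 < q ->
  Gamma (z * p + (1 - z) * q) <= expR (z * ln (Gamma p) + (1 - z) * ln (Gamma q)).
Proof.
move=> z01 p0 q0; have [z0 z1] := andP z01.
have r0 : 0 < z * p + (1 - z) * q.
  have [->|zp] := eqVneq z 0; first by rewrite mul0r add0r subr0 mul1r.
  rewrite ltr_pwDl//; first by rewrite mulr_gt0// lt0r zp.
  by rewrite mulr_ge0 ?subr_ge0// ltW.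
have H := fun c d => @Gamma_le_comb c d _ p q r0 p0 q0.
have P0 := Gamma_gt0 p0; have Q0 := Gamma_gt0 q0; move: H P0 Q0.
move: (Gamma (z * p + (1 - z) * q)) => G; move: (Gamma p) (Gamma q) => P Q H P0 Q0.
set C := expR _; have C0 : 0 < C by exact: expR_gt0.
rewrite [leRHS](_ : _ = C * z / P * P + C * (1 - z) / Q * Q).
  apply: H => [||t]; rewrite ?(mulr_ge0, invr_ge0, subr_ge0, ltW P0, ltW Q0, ltW C0)//.
  have [t0|t0] := leP t 0; first by rewrite !(gamma_density0 _ t0) !mulr0 addr0.
  (* For t > 0 the logarithm of the density of parameter a, namely (a - 1) ln t - t, is affine in
     a. *)
  rewrite !(gamma_densityE _ t0) /powR (gt_eqF t0) -!expRD.
  rewrite (_ : _ + - t = z * ((p - 1) * ln t - t) + (1 - z) * ((q - 1) * ln t - t)).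
    have := expR_mean ((p - 1) * ln t - t) ((q - 1) * ln t - t) (ln P) (ln Q) z01.
    by rewrite -/C (lnK P0) (lnK Q0).
  by ring.
by rewrite !mulfVK ?gt_eqF// -mulrDr addrC subrK mulr1.
Qed.

End Gamma_log_convex.

(** * Wallis integrals and Euler's product for the sine *)

Section wallis.
Context {R : realType}.
Notation mu := (@lebesgue_measure R).
Implicit Types (a b c s x y : R) (n : nat) (f g F : R -> R).

Lemma is_derive1M f g x a b : is_derive x 1 f a -> is_derive x 1 g b ->
  is_derive x 1 (fun y => f y * g y) (a * g x + f x * b).
Proof.
by move=> fa gb; apply: (is_derive_eq (is_deriveM fa gb)); rewrite /GRing.scale/= addrC mulrC.
Qed.

Lemma is_derive1B f g x a b : is_derive x 1 f a -> is_derive x 1 g b ->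
  is_derive x 1 (fun y => f y - g y) (a - b).
Proof. by move=> fa gb; exact: is_deriveB. Qed.

Lemma is_derive1Z c f x a : is_derive x 1 f a -> is_derive x 1 (fun y => c * f y) (c * a).
Proof.
move=> fa; apply: (is_derive_eq (is_derive1M (is_derive_cst c x 1) fa)).
by rewrite mul0r add0r.
Qed.

Lemma is_derive1_cosX x n : is_derive x 1 (fun y => cos y ^+ n) (- n%:R * sin x * cos x ^+ n.-1).
Proof.
elim: n => [|n IHn].
  rewrite (_ : (fun y => cos y ^+ 0) = cst 1)//.
  by apply: (is_derive_eq (is_derive_cst _ _ _)); rewrite oppr0 !mul0r.
rewrite (_ : (fun y => cos y ^+ n.+1) = (fun y => cos y * cos y ^+ n)).
  apply: (is_derive_eq (is_derive1M (is_derive_cos x) IHn)) => /=.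
  by case: n {IHn} => [|n]; rewrite ?expr0 ?exprS -?natr1/=; ring.
by apply/funext => y; rewrite exprS.
Qed.

Lemma is_derive1_cosZ x c : is_derive x 1 (fun y => cos (c * y)) (- c * sin (c * x)).
Proof.
have H : is_derive x 1 (fun y => c * y) c.
  by apply: (is_derive_eq (is_derive1Z c (is_derive_id x 1))); rewrite mulr1.
by apply: (is_derive_eq (is_derive1_comp (is_derive_cos (c * x)) H)); ring.
Qed.

Lemma is_derive1_sinZ x c : is_derive x 1 (fun y => sin (c * y)) (c * cos (c * x)).
Proof.
have H : is_derive x 1 (fun y => c * y) c.
  by apply: (is_derive_eq (is_derive1Z c (is_derive_id x 1))); rewrite mulr1.
by apply: (is_derive_eq (is_derive1_comp (is_derive_sin (c * x)) H)); ring.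
Qed.

Lemma is_derive1_continuous f g : (forall x, is_derive x 1 f (g x)) -> continuous f.
Proof.
move=> fg x; apply/differentiable_continuous/derivable1_diffP.
by case: (fg x).
Qed.

Lemma Rintegral_is_derive1 a b F f : a < b -> (forall x, is_derive x 1 F (f x)) ->
  continuous f -> \int[mu]_(x in `[a, b]) f x = F b - F a.
Proof.
move=> ab dF cf; have cF := is_derive1_continuous dF.
rewrite /Rintegral (@continuous_FTC2 _ f F)//.
- by apply: continuous_subspaceT.
- split; first by move=> x _; case: (dF x).
  + by apply: cvg_at_right_filter; exact: cF.
  + by apply: cvg_at_left_filter; exact: cF.
- by move=> x _; rewrite derive1E; case: (dF x).
Qed.

Lemma ge0_is_derive1_le a b F f : a <= b -> (forall x, is_derive x 1 F (f x)) ->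
  (forall x, a < x < b -> 0 <= f x) -> F a <= F b.
Proof.
move=> ab dF f0; apply: (@ger0_derive1_le_cc R F a b).
- by move=> x _; case: (dF x).
- by move=> x; rewrite in_itv/= => /f0; rewrite derive1E; case: (dF x) => _ ->.
- by apply: continuous_subspaceT; exact: is_derive1_continuous dF.
- by rewrite in_itv/= lexx.
- by rewrite in_itv/= lexx ab.
- by [].
Qed.

Lemma mul_cos_le_sin x : 0 <= x <= pi / 2 -> x * cos x <= sin x.
Proof.
move=> x02; have [x0 x2] := andP x02.
have d y : is_derive y 1 (fun z => sin z - z * cos z) (y * sin y).
  apply: (is_derive_eq (is_derive1B (is_derive_sin y)
    (is_derive1M (is_derive_id y 1) (is_derive_cos y)))).
  by ring.
rewrite -subr_ge0 (le_trans _ (ge0_is_derive1_le x0 d _))//.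
  by rewrite sin0 mul0r subr0.
move=> y /andP[y0 y2]; rewrite mulr_ge0 ?(ltW y0)// sin_ge0_pi// (ltW y0)/=.
by have := pi_ge0 R; lra.
Qed.

Lemma sin_le_id x : 0 <= x -> sin x <= x.
Proof.
move=> x0.
have d y : is_derive y 1 (fun z => z - sin z) (1 - cos y).
  exact: is_derive1B (is_derive_id y 1) (is_derive_sin y).
rewrite -subr_ge0; apply: (le_trans _ (ge0_is_derive1_le x0 d _)).
  by rewrite sin0 subr0.
by move=> y _; rewrite subr_ge0; exact: cos_le1.
Qed.

(** A deformation of Wallis' integral (s = 0). It carries sin (s pi) at n = 0, while for 0 <= s <= 1
    its quotient by [wallis 0 n] tends to 1 along even n. *)
Definition wallis s n := \int[mu]_(x in `[0, pi / 2]) (cos (2 * s * x) * cos x ^+ n).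

Lemma continuous_wallis s n : continuous (fun x : R => cos (2 * s * x) * cos x ^+ n).
Proof.
exact: is_derive1_continuous (fun x => is_derive1M (is_derive1_cosZ x (2 * s)) (is_derive1_cosX x n)).
Qed.

Lemma integrable_itv_continuous a b f : continuous f -> mu.-integrable `[a, b] (EFin \o f).
Proof.
move=> cf; apply: continuous_compact_integrable; first exact: segment_compact.
exact: continuous_subspaceT.
Qed.

Lemma wallis_rec s n :
  (n.+2%:R * n.+1%:R) * wallis s n = (n.+2%:R ^+ 2 - (2 * s) ^+ 2) * wallis s n.+2.
Proof.
have pi20 : 0 < pi / 2 :> R by rewrite divr_gt0 ?pi_gt0.
(* F collects the boundary terms of two integrations by parts; it vanishes at 0 through the sines
   and at pi / 2 through the cosine. *)
pose F x := n.+2%:R * (cos (2 * s * x) * (cos x ^+ n.+1 * sin x)) -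
  2 * s * (sin (2 * s * x) * cos x ^+ n.+2).
pose f x := (n.+2%:R ^+ 2 - (2 * s) ^+ 2) * (cos (2 * s * x) * cos x ^+ n.+2)
  - n.+2%:R * n.+1%:R * (cos (2 * s * x) * cos x ^+ n).
have dF x : is_derive x 1 F (f x).
  have D1 := is_derive1M (is_derive1_cosZ x (2 * s))
    (is_derive1M (is_derive1_cosX x n.+1) (is_derive_sin x)).
  have D2 := is_derive1M (is_derive1_sinZ x (2 * s)) (is_derive1_cosX x n.+2).
  apply: (is_derive_eq (is_derive1B (is_derive1Z n.+2%:R D1) (is_derive1Z (2 * s) D2))).
  have := sin2cos2 x => E.
  rewrite /f/= !exprS; transitivity (
    n.+2%:R * (n.+1%:R * (cos x ^+ n * cos (2 * s * x)) * - sin x ^+ 2 + cos (2 * s * x) * (cos x * cos x ^+ n) * cos x) - (2 * s) ^+ 2 * (cos (2 * s * x) * (cos x * (cos x * cos x ^+ n)))).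
    by ring.
  by rewrite E -!natr1; ring.
have cf : continuous f.
  move=> x; apply: cvgB; apply: cvgM; try exact: cvg_cst; exact: continuous_wallis.
have := Rintegral_is_derive1 pi20 dF cf.
rewrite /F cos_pihalf !expr0n !mul0r !mulr0 sin0 mul0r !mulr0 subrr/=.
rewrite /f RintegralB//; last 2 first.
- apply: integrable_itv_continuous => x; apply: cvgM; first exact: cvg_cst.
  exact: continuous_wallis.
- apply: integrable_itv_continuous => x; apply: cvgM; first exact: cvg_cst.
  exact: continuous_wallis.
rewrite !RintegralZl//; last 2 first.
- by apply: integrable_itv_continuous; exact: continuous_wallis.
- by apply: integrable_itv_continuous; exact: continuous_wallis.
by move/eqP; rewrite subr_eq0 => /eqP ->.
Qed.

Lemma wallis0 s : 0 < s -> wallis s 0 = sin (s * pi) / (2 * s).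
Proof.
move=> s0; have s20 : 2 * s != 0 by rewrite mulf_neq0 ?pnatr_eq0// gt_eqF.
have dF x : is_derive x 1 (fun y => (2 * s)^-1 * sin (2 * s * y)) (cos (2 * s * x) * cos x ^+ 0).
  apply: (is_derive_eq (is_derive1Z (2 * s)^-1 (is_derive1_sinZ x (2 * s)))).
  by rewrite mulKf// expr0 mulr1.
have pi20 : 0 < pi / 2 :> R by rewrite divr_gt0 ?pi_gt0.
rewrite /wallis (Rintegral_is_derive1 pi20 dF); last exact: continuous_wallis.
rewrite mulr0 sin0 mulr0 subr0 mulrC; congr (sin _ / _).
by field.
Qed.

Lemma wallis00 : wallis 0 0 = pi / 2.
Proof.
rewrite /wallis; under eq_Rintegral do rewrite mulr0 mul0r cos0 expr0 mulr1.
rewrite Rintegral_cst//= lebesgue_measure_itv/= lte_fin divr_gt0 ?pi_gt0//=.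
by rewrite mul1r oppr0 addr0.
Qed.

Lemma wallis_even_gt0 n : 0 < wallis 0 n.*2.
Proof.
elim: n => [|n IHn]; first by rewrite wallis00 divr_gt0 ?pi_gt0.
have := wallis_rec 0 n.*2; rewrite mulr0 expr0n subr0 -doubleS => E.
have : 0 < n.*2.+2%:R ^+ 2 * wallis 0 n.+1.*2 by rewrite -E !mulr_gt0// ltr0n.
by rewrite pmulr_rgt0// exprn_gt0// ltr0n.
Qed.

(** The left-hand side is the integral of cos^(2n) x sin^2 x, which controls the error when
    [wallis s] is compared with [wallis 0]. *)
Lemma wallis_even_diff n :
  wallis 0 n.*2 - wallis 0 n.+1.*2 = wallis 0 n.+1.*2 / n.*2.+1%:R.
Proof.
have E : n.*2.+2%:R * n.*2.+1%:R * wallis 0 n.*2 = n.*2.+2%:R ^+ 2 * wallis 0 n.+1.*2.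
  by rewrite wallis_rec mulr0 expr0n subr0.
have n1 : n.*2.+1%:R != 0 :> R by rewrite pnatr_eq0.
have n2 : n.*2.+2%:R != 0 :> R by rewrite pnatr_eq0.
have -> : wallis 0 n.*2 = n.*2.+2%:R * wallis 0 n.+1.*2 / n.*2.+1%:R.
  by apply: (mulfI (mulf_neq0 n2 n1)); rewrite E; field.
by rewrite -[n.*2.+2%:R]natr1; field.
Qed.

(* 1 - cos (2 s x) = 2 sin^2 (s x) <= 2 s^2 x^2 and x^2 cos^2 x <= sin^2 x. *)
Lemma wallis_even_ratio s n : 0 <= s <= 1 ->
  wallis 0 n.+1.*2 * (1 - 2 * s ^+ 2 / n.*2.+1%:R) <= wallis s n.+1.*2 <= wallis 0 n.+1.*2.
Proof.
move=> /andP[s0 s1].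
have le1 x :
    cos (2 * s * x) * cos x ^+ n.+1.*2 <= cos (2 * 0 * x) * cos x ^+ n.+1.*2.
  rewrite mulr0 mul0r cos0; apply: ler_wpM2r; last exact: cos_le1.
  by rewrite -mul2n exprM exprn_ge0// sqr_ge0.
have ic t m : mu.-integrable `[0, pi / 2] (EFin \o (fun x => cos (2 * t * x) * cos x ^+ m)).
  by apply: integrable_itv_continuous; exact: continuous_wallis.
apply/andP; split; last first.
  by apply: le_Rintegral => // x _; exact: le1.
(* By [wallis_even_diff] the error bound is an integral too, and a pointwise inequality of
   integrands is enough. *)
rewrite mulrBr mulr1 mulrCA mulrA -mulrA -wallis_even_diff.
rewrite lerBlDl -lerBlDr /wallis -!RintegralB// -RintegralZl//; last first.
  by have := integrableB _ (ic 0 n.*2) (ic 0 n.+1.*2); apply.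
apply: le_Rintegral => //.
- by have := integrableB _ (ic 0 n.+1.*2) (ic s n.+1.*2); apply.
- apply: (@integrableZl _ _ _ mu _ _ (2 * s ^+ 2) (EFin \o (fun x => cos (2 * 0 * x) * cos x ^+ n.*2 - cos (2 * 0 * x) * cos x ^+ n.+1.*2))) => //.
  by have := integrableB _ (ic 0 n.*2) (ic 0 n.+1.*2); apply.
move=> x/=; rewrite in_itv/= => x02; have /andP[x0 x2] := x02.
have cx : 0 <= cos x by rewrite cos_ge0_pihalf// x2 andbT (le_trans _ x0)// oppr_le0 divr_ge0// pi_ge0.
rewrite mulr0 mul0r cos0 !mul1r (_ : 2 * s * x = (s * x) *+ 2); last by rewrite mulr2n; ring.
rewrite cos_mulr2n cos2sin2 doubleS !exprS; set c := cos x ^+ n.*2.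
have c0 : 0 <= c by exact: exprn_ge0.
have sx : sin (s * x) ^+ 2 <= (s * x) ^+ 2.
  have sx0 : 0 <= s * x by rewrite mulr_ge0.
  have sxx : s * x <= x by rewrite ler_piMl.
  have pi0 := pi_ge0 R.
  by rewrite ler_sqr ?nnegrE// ?sin_le_id// sin_ge0_pi// sx0/=; lra.
have xc : (x * cos x) ^+ 2 <= sin x ^+ 2.
  have pi0 := pi_ge0 R.
  rewrite ler_sqr ?nnegrE ?mul_cos_le_sin// ?mulr_ge0// sin_ge0_pi// x0/=; lra.
rewrite [leLHS](_ : _ = c * (2 * (cos x ^+ 2 * sin (s * x) ^+ 2))); last by rewrite mulr2n; ring.
rewrite [leRHS](_ : _ = c * (2 * (s ^+ 2 * (1 - cos x ^+ 2)))); last by ring.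
rewrite ler_wpM2l// ler_pM2l// -sin2cos2.
apply: (@le_trans _ _ (cos x ^+ 2 * (s * x) ^+ 2)); first by rewrite ler_wpM2l ?sqr_ge0.
rewrite (_ : _ * _ = s ^+ 2 * (x * cos x) ^+ 2); last by ring.
by rewrite ler_wpM2l ?sqr_ge0.
Qed.

Definition sine_product s n := \prod_(j < n) (1 - s ^+ 2 / j.+1%:R ^+ 2).

(* The quotient wallis s n / wallis 0 n at n = 0 is sin (s pi) / (s pi); the
   recurrence in n extracts the factors 1 - s^2 / j^2 of Euler's product from it. *)
Lemma sine_product_bounds s n : 0 < s < 1 ->
  sine_product s n.+1 * (1 - 2 * s ^+ 2 / n.*2.+1%:R) <= sin (s * pi) / (s * pi)
    <= sine_product s n.+1.
Proof.
move=> /andP[s0 s1]; pose q := sine_product s n.+1; rewrite -/q.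
have q0 : 0 <= q.
  apply: prodr_ge0 => j _; rewrite subr_ge0 ler_pdivrMr ?exprn_gt0// mul1r.
  rewrite ler_sqr ?nnegrE ?(ltW s0)//; apply: (le_trans (ltW s1)).
  by rewrite ler1n.
have W0 := wallis_even_gt0.
have E m : sin (s * pi) / (s * pi) =
    sine_product s m * (wallis s m.*2 / wallis 0 m.*2).
  elim: m => [|m ->].
    rewrite /sine_product big_ord0 mul1r double0 wallis0// wallis00.
    move: (pi_gt0 R) (sin _); move: (pi : R) => p p0 z; field.
    by rewrite !gt_eqF.
  rewrite {2}/sine_product big_ord_recr/= -mulrA; congr (_ * _).
  have R1 := wallis_rec s m.*2; have R2 := wallis_rec 0 m.*2.
  rewrite mulr0 expr0n subr0 in R2.
  have n1 : m.*2.+1%:R != 0 :> R by rewrite pnatr_eq0.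
  have n2 : m.*2.+2%:R != 0 :> R by rewrite pnatr_eq0.
  have n3 : m.+1%:R != 0 :> R by rewrite pnatr_eq0.
  have w1 := gt_eqF (W0 m); have w2 := gt_eqF (W0 m.+1).
  apply: (mulfI (mulf_neq0 n2 n1)).
  rewrite [LHS]mulrA R1.
  have -> : wallis 0 m.*2 = m.*2.+2%:R ^+ 2 * wallis 0 m.+1.*2 / (m.*2.+2%:R * m.*2.+1%:R).
    by rewrite -R2 mulrAC divff ?mulf_neq0// mul1r.
  have D : m.*2.+2%:R = 2 * m.+1%:R :> R by rewrite -doubleS -muln2 natrM mulrC.
  rewrite D -doubleS in n2 *; move: n1 n3 w2.
  move: (m.*2.+1%:R) (m.+1%:R) (wallis 0 _) => a c w a0 c0 w0; field.
  by rewrite a0 c0 w0.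
have := wallis_even_ratio n (_ : 0 <= s <= 1); rewrite (ltW s0) (ltW s1) => /(_ isT).
move=> /andP[lo hi]; rewrite (E n.+1) -/q; apply/andP; split.
  by rewrite ler_wpM2l// ler_pdivlMr// mulrC.
by rewrite ler_piMr// ler_pdivrMr// mul1r.
Qed.

End wallis.

(** * The reflection formula and its extension to larger arguments *)

Section reflection.
Context {R : realType}.
Implicit Types (r s x : R) (n : nat).

(** Apart from the leading s, the factors pair off as (j + s)(j - s) = j^2 (1 - s^2 / j^2). *)
Lemma rising_sine_product s n :
  rising s n.+1 * rising (1 - s) n = s * n`!%:R ^+ 2 * sine_product s n.
Proof.
elim: n => [|n IHn].
  by rewrite risingS !rising0 /sine_product big_ord0 fact0; ring.
rewrite risingS [rising (1 - s) _]risingS mulrACA IHn.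
rewrite /sine_product big_ord_recr/= factS natrM -/(sine_product s n).
have n0 : n.+1%:R != 0 :> R by rewrite pnatr_eq0.
rewrite -natr1 in n0 *.
by field.
Qed.

(** Lower bound: n + 2 is the midpoint of n + 2 - s and n + 2 + s. Upper bound: n + 2 + s lies
    between n + 2 and n + 3, and n + 2 - s between n + 1 and n + 2; log-convexity gives ((n + 2) /
    (n + 1))^s, at most 1 + 1 / (n + 1). *)
Lemma Gamma_double_bounds s n : 0 < s < 1 ->
  1 <= Gamma (n.+2%:R + s) * Gamma (n.+2%:R - s) / n.+1`!%:R ^+ 2 <= 1 + n.+1%:R^-1.
Proof.
move=> /andP[s0 s1].
have F0 m : 0 < m`!%:R :> R by rewrite ltr0n fact_gt0.
have n2 : 1 < n.+2%:R :> R by rewrite ltr1n.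
have Gp : 0 < n.+2%:R + s by rewrite addr_gt0.
have Gm : 0 < n.+2%:R - s by lra.
have s01 : 0 <= s <= 1 by rewrite !ltW.
have h2 : 0 <= (2^-1 : R) <= 1 by lra.
have FE : n.+1`!%:R = n.+1%:R * n`!%:R :> R by rewrite factS natrM.
apply/andP; split.
  rewrite ler_pdivlMr ?exprn_gt0// mul1r -Gamma_nat.
  have := Gamma_log_convex h2 Gp Gm.
  have -> : 2^-1 * (n.+2%:R + s) + (1 - 2^-1) * (n.+2%:R - s) = n.+2%:R by field.
  move: (Gamma_gt0 Gp) (Gamma_gt0 Gm); rewrite Gamma_nat.
  move: (Gamma _) (Gamma _) => Q P P0 Q0 le.
  have -> : P * Q = expR (2^-1 * ln P + (1 - 2^-1) * ln Q) ^+ 2.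
    rewrite -expRM_natl (_ : 2%:R * _ = ln P + ln Q); last by field.
    by rewrite expRD !lnK.
  by rewrite ler_sqr ?nnegrE ?expR_ge0// ltW.
have n1 : 0 < n.+1%:R :> R by rewrite ltr0n.
have n20 : 0 < n.+2%:R :> R by rewrite ltr0n.
have n30 : 0 < n.+3%:R :> R by rewrite ltr0n.
have up := Gamma_log_convex s01 n30 n20.
have dn := Gamma_log_convex s01 n1 n20.
rewrite !Gamma_nat in up dn.
rewrite (_ : s * n.+3%:R + _ = n.+2%:R + s) in up; last by rewrite -(natr1 n.+2); ring.
rewrite (_ : s * n.+1%:R + _ = n.+2%:R - s) in dn; last by rewrite -(natr1 n.+1); ring.
rewrite ler_pdivrMr ?exprn_gt0//.
apply: (le_trans (ler_pM (ltW (Gamma_gt0 Gp)) (ltW (Gamma_gt0 Gm)) up dn)).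
rewrite -expRD factS natrM FE !lnM ?posrE//.
set L2 := ln n.+2%:R; set L1 := ln n.+1%:R; set F := ln n`!%:R.
rewrite [X in expR X](_ : _ = s * (L2 - L1) + ln (n.+1`!%:R ^+ 2)); last first.
  by rewrite lnXn// FE lnM ?posrE// -/L1 -/F mulr2n; ring.
rewrite expRD lnK ?posrE ?exprn_gt0// FE ler_pM2r ?exprn_gt0 ?mulr_gt0//.
apply: (@le_trans _ _ (expR (L2 - L1))).
  by rewrite ler_expR ler_piMl ?(ltW s1)// subr_ge0 ler_ln ?posrE// ler_nat.
rewrite expRD expRN !lnK ?posrE// -(natr1 n.+1) mulrDl mul1r divff ?gt_eqF//.
Qed.

(** The left-hand side X does not depend on n, but by XE it is a product of two quantities that tend
    to 1; explicit bounds squeeze it between 1 - 2 / (n + 1) and 1 + 1 / (n + 1). *)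
Lemma Gamma_reflection s : 0 < s < 1 ->
  Gamma s * Gamma (1 - s) * sin (s * pi) / pi = 1.
Proof.
move=> s01; have /andP[s0 s1] := s01.
set X := _ / pi.
have q0 n : 0 < sine_product s n.
  apply: prodr_gt0 => j _; rewrite subr_gt0 ltr_pdivrMr ?exprn_gt0// mul1r.
  by rewrite ltr_sqr ?nnegrE ?(ltW s0)// (lt_le_trans s1)// ler1n.
have XE n : X = Gamma (n.+2%:R + s) * Gamma (n.+2%:R - s) / n.+1`!%:R ^+ 2 *
    (sin (s * pi) / (s * pi) / sine_product s n.+1).
  have -> : n.+2%:R + s = s + n.+2%:R by rewrite addrC.
  have -> : n.+2%:R - s = (1 - s) + n.+1%:R by rewrite -(natr1 n.+1); ring.
  have s1' : 0 < 1 - s by rewrite subr_gt0.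
  rewrite (Gamma_rising _ s0) (Gamma_rising _ s1') [_ * Gamma s * _]mulrACA rising_sine_product /X.
  have f0 : n.+1`!%:R != 0 :> R by rewrite pnatr_eq0 -lt0n fact_gt0.
  have p0 : pi != 0 :> R by rewrite gt_eqF// pi_gt0.
  move: (gt_eqF s0) f0 (lt0r_neq0 (q0 n.+1)) p0; move: (sin _) (Gamma s) (Gamma _) => z a b.
  move: (n.+1`!%:R) (sine_product _ _) (pi : R) => c d p s0' c0 d0 p0; field.
  by rewrite c0 d0 p0 s0'.
have t0 : 0 <= sin (s * pi) / (s * pi).
  rewrite divr_ge0 ?mulr_ge0 ?pi_ge0 ?(ltW s0)// sin_ge0_pi// mulr_ge0 ?pi_ge0 ?(ltW s0)//=.
  by rewrite ler_piMl ?pi_ge0 ?(ltW s1).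
have lo n : 1 - 2 / n.+1%:R <= X.
  have /andP[G1 _] := Gamma_double_bounds n s01.
  have /andP[S1 _] := sine_product_bounds n s01.
  rewrite (XE n); apply: (@le_trans _ _ (sin (s * pi) / (s * pi) / sine_product s n.+1)).
    rewrite ler_pdivlMr// mulrC; apply: le_trans S1; rewrite ler_pM2l// lerD2l lerN2.
    rewrite ler_pM ?mulr_ge0 ?sqr_ge0 ?(ltW s0)// ?invr_ge0//.
      by rewrite ger_pMr// expr_le1// ltW.
    by rewrite lef_pV2 ?posrE ?ltr0n// ler_nat ltnS -addnn leq_addr.
  by rewrite ler_peMl// divr_ge0// ltW.
have hi n : X <= 1 + n.+1%:R^-1.
  have /andP[G0 G1] := Gamma_double_bounds n s01.
  have /andP[_ S1] := sine_product_bounds n s01.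
  rewrite (XE n) -[leRHS]mulr1 ler_pM//; first exact: le_trans ler01 G0.
    by rewrite divr_ge0// ltW.
  by rewrite ler_pdivrMr// mul1r.
apply/le_anti/andP; split; rewrite leNgt; apply/negP => /ltr_add_invr[n].
  by rewrite ltNge hi.
(* At index 2n + 1 the lower bound reads 1 - 1 / (n + 1) <= X. *)
move=> nX; have := lo n.*2.+1.
have -> : n.*2.+2%:R = 2 * n.+1%:R :> R by rewrite -doubleS -muln2 natrM mulrC.
by rewrite invfM mulVKf ?pnatr_eq0// lerBlDr leNgt nX.
Qed.

(** Induction on n. If r < n + 1, the second Gamma factor is lowered by [GammaS]; otherwise r itself
    is lowered by 1, and the sine changes sign. *)
Lemma Gamma_sin_rising r n : 0 < r < n.+1%:R ->
  Gamma r * Gamma (n.+1%:R - r) * sin (r * pi) / pi = rising (1 - r) n.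
Proof.
elim: n r => [|n IHn] r /andP[r0 rn].
  by rewrite rising0 Gamma_reflection// r0.
have [rn1|rn1] := ltP r n.+1%:R.
  rewrite risingS -IHn ?r0//.
  have -> : n.+2%:R - r = n.+1%:R - r + 1 by rewrite -(natr1 n.+1); ring.
  have d0 : 0 < n.+1%:R - r by rewrite subr_gt0.
  by rewrite (GammaS d0) -natr1; ring.
(* Here r - 1 = 0 would be outside the range of the induction hypothesis; both sides vanish. *)
have [->|r1] := eqVneq r 1.
  by rewrite mul1r sinpi mulr0 mul0r subrr risingSl mul0r.
have r1' : 0 < r - 1.
  by rewrite subr_gt0 lt_neqAle eq_sym r1 (le_trans _ rn1)// ler1n.
rewrite risingSl.
have := IHn (r - 1); rewrite r1' ltrBlDr natr1 rn => /(_ isT).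
rewrite (_ : 1 - (r - 1) = 1 - r + 1); last by ring.
move=> <-.
have -> : n.+2%:R - r = n.+1%:R - (r - 1) by rewrite -(natr1 n.+1); ring.
have -> : sin (r * pi) = - sin ((r - 1) * pi).
  by rewrite -sinDpi mulrBl mul1r subrK.
rewrite -{1}(subrK 1 r) (GammaS r1'); ring.
Qed.

End reflection.

(** * The Legendre coefficients *)

Section legendre_fracint.
Context {R : realType}.
Notation mu := (@lebesgue_measure R).
Implicit Types (r x : R) (n j : nat).

Definition legendre_frac n r := frac_poly (legendre_bin (R := R) n) n.+1 r.

Lemma fracintR_legendre n r x : 0 <= r -> x <= 1 ->
  fracintR r (fun y => (legendre R n).[y]) x = legendre_frac n r x.
Proof.
move=> r0 x1; have [->|rn0] := eqVneq r 0; first by rewrite /fracintR eqxx legendreE.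
have rp : 0 < r by rewrite lt0r rn0.
rewrite /legendre_frac -{2}(add0r r) -(fracintR_frac_poly _ _ rp)// /fracintR (negbTE rn0).
congr (_ * _); apply: eq_Rintegral => y; rewrite inE/= in_itv/= => /andP[_ y1].
by rewrite legendreE// ltW.
Qed.

(** These are the boundary terms at -1 when u is integrated by parts. The factor of index n - j in
    the rising product is zero. *)
Lemma legendre_frac_nat n j : (0 < j <= n)%N -> legendre_frac n j%:R (-1) = 0.
Proof.
move=> /andP[j0 jn]; rewrite /legendre_frac frac_poly_legendre_bin_N1//.
rewrite (@rising_eq0 _ (n - j)%N) ?mulr0 ?mul0r// ?natrB//; last by ring.
by rewrite ltn_subrL j0 (leq_trans j0).
Qed.

Lemma legendre_frac_N1 n r : 0 < r < n.+1%:R ->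
  legendre_frac n r (-1) =
  (-1) ^+ n * 2 `^ r * Gamma r * sin (r * pi) / pi *
  (Gamma (n.+1%:R - r) / Gamma (n.+1%:R + r)).
Proof.
move=> rn; have /andP[r0 _] := rn.
rewrite /legendre_frac frac_poly_legendre_bin_N1 ?(ltW r0)// rising_rev -Gamma_sin_rising//.
rewrite (_ : n%:R + r + 1 = n.+1%:R + r); last by rewrite -natr1; ring.
by move: (Gamma _) (Gamma _) (Gamma _) (sin _) (_ `^ _) => *; ring.
Qed.

End legendre_fracint.

Section absolutely_continuous_by_parts.
Context {R : realType}.
Notation mu := (@lebesgue_measure R).
Notation D := (`]-1, 1[%classic : set R).
Implicit Types (s x : R) (c : nat -> R) (n : nat) (f g h w : R -> R).

Let ltN11 : -1 < 1 :> R. Proof. by lra. Qed.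

Lemma abs_continuous_measurable_oo w : abs_continuous (-1) 1 w -> measurable_fun D w.
Proof.
move=> acw; apply: measurable_funS (subspace_continuous_measurable_fun _
  (abs_continuous_continuous ltN11 acw)) => //.
exact: subset_itv_oo_cc.
Qed.

Lemma integrable_mul_bounded (A : set R) f h (M : R) : measurable A ->
  mu.-integrable A (EFin \o f) -> measurable_fun A h -> (forall x, A x -> `|h x| <= M) ->
  mu.-integrable A (EFin \o (fun x => f x * h x)).
Proof.
move=> mA fi mh hM; have bh : [bounded h x | x in A].
  exists M; split; first exact: num_real.
  by move=> N MN x Ax; apply: le_trans (hM x Ax) (ltW MN).
exact: (@integrableMl _ _ _ mu A mA (EFin \o f) h fi mh bh).
Qed.

Lemma Rintegral_add_scale (A : set R) f g (k : R) : measurable A ->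
  mu.-integrable A (EFin \o f) -> mu.-integrable A (EFin \o g) ->
  \int[mu]_(x in A) (k * f x + g x) = k * \int[mu]_(x in A) f x + \int[mu]_(x in A) g x.
Proof.
move=> mA fi gi; rewrite RintegralD; [|exact: mA| |exact: gi].
  by rewrite RintegralZl.
by apply: (integrableZl _ k fi).
Qed.

Lemma fracintL1 g x : fracintL 1 g x = \int[mu]_(y in `]-1, x[) g y.
Proof.
rewrite /fracintL oner_eq0 Gamma1 invr1 mul1r; apply: eq_Rintegral => y _.
by rewrite subrr powRr0 divr1.
Qed.

(** As w - w(-1) = I_{-1+}^1 w', this is [fracint_by_parts] for a = 1. There is no boundary term at
    1, where [frac_poly] of order s + 1 vanishes. *)
Lemma abs_continuous_by_parts w w' c n s : 0 <= s ->
  abs_continuous (-1) 1 w -> w' = derive1 w %[ae mu in D] ->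
  \int[mu]_(x in D) (w x * frac_poly c n s x) =
  w (-1) * frac_poly c n (s + 1) (-1) +
  \int[mu]_(x in D) (w' x * frac_poly c n (s + 1) x).
Proof.
move=> s0 acw ww'; have [g [ig wg gw]] := abs_continuous_density ltN11 acw.
have mD : measurable D by exact: measurable_itv.
have Dy : (mu D < +oo)%E by rewrite lebesgue_measure_itv/=; case: ifP; rewrite -?EFinB ltry.
have igD : mu.-integrable D (EFin \o g) by exact: integrableS ig.
have [M fM] := frac_poly_bounded c n s0.
have fMD x : x \in `]-1, 1[ -> `|frac_poly c n s x| <= M.
  by rewrite in_itv/= => /andP[/ltW ? /ltW ?]; apply: fM; apply/andP.
have mf t : measurable_fun D (frac_poly c n t).
  by apply: measurable_funTS; exact: measurable_frac_poly.
have iphi : mu.-integrable D (EFin \o frac_poly c n s).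
  by apply: (@bounded_integrable _ _ _ M) => // x Dx; exact: fMD.
have mw := abs_continuous_measurable_oo acw.
have iw : mu.-integrable D (EFin \o (fun x => w x - w (-1))).
  apply: (@integrableS _ _ _ mu `[-1, 1]); rewrite //=; first exact: subset_itv_oo_cc.
  apply: continuous_compact_integrable; first exact: segment_compact.
  move=> x; apply: cvgB; last exact: cvg_cst.
  exact: (abs_continuous_continuous ltN11 acw).
have wE x : x \in `]-1, 1[ -> fracintL 1 g x = w x - w (-1).
  move=> xD; rewrite fracintL1 wg; first by rewrite addrC addKr.
  by apply: subset_itv_oo_cc.
have fR1 x : x <= 1 -> fracintR 1 (frac_poly c n s) x = frac_poly c n (s + 1) x.
  by move=> x1; exact: fracintR_frac_poly.
have R1 f : fracintR 1 f (-1) = \int[mu]_(x in D) f x.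
  rewrite /fracintR oner_eq0 Gamma1 invr1 mul1r; apply: eq_Rintegral => y _.
  by rewrite subrr powRr0 divr1.
(* The constant w(-1) is split off; its part is the boundary term. *)
have -> : \int[mu]_(x in D) (w x * frac_poly c n s x) =
    \int[mu]_(x in D) (w (-1) * frac_poly c n s x + (w x - w (-1)) * frac_poly c n s x).
  by apply: eq_Rintegral => x _; move: (w x) (frac_poly _ _ _ _) => *; ring.
have i2 : mu.-integrable D (EFin \o (fun x => (w x - w (-1)) * frac_poly c n s x)).
  by exact: integrable_mul_bounded mD iw (mf s) fMD.
rewrite (Rintegral_add_scale (w (-1)) mD iphi i2) -(R1 (frac_poly c n s)) fR1; last by lra.
suff E : \int[mu]_(x in D) ((w x - w (-1)) * frac_poly c n s x) =
  \int[mu]_(x in D) (w' x * frac_poly c n (s + 1) x) by exact: (congr1 _ E).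
transitivity (\int[mu]_(x in D) (fracintL 1 g x * frac_poly c n s x)).
  by apply: eq_Rintegral => x; rewrite inE/= => /wE ->.
rewrite (fracint_by_parts ltr01 igD (mf s) fMD).
transitivity (\int[mu]_(x in D) (g x * frac_poly c n (s + 1) x)).
  by apply: eq_Rintegral => x; rewrite inE/= in_itv/= => /andP[_ /ltW x1]; rewrite fR1.
apply/esym/ae_eq_Rintegral => //.
  have mg : measurable_fun D g by apply/measurable_EFinP; exact: measurable_int igD.
  exact: measurable_funM mg (mf _).
apply: ae_eq_mul2r; apply: ae_eq_trans ww' _; exact: ae_eq_sym.
Qed.

End absolutely_continuous_by_parts.

(** * Pointwise derivatives from almost everywhere ones *)

Section derivative_chain.
Context {R : realType}.
Notation mu := (@lebesgue_measure R).
Notation D := (`]-1, 1[%classic : set R).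
Implicit Types (a s x : R) (j k n : nat) (f g u w : R -> R).

Let ltN11 : -1 < 1 :> R. Proof. by lra. Qed.

Lemma eq_oo_derive1 f g x : x \in `]-1, 1[ -> {in `]-1, 1[, f =1 g} ->
  derive1 f x = derive1 g x.
Proof.
move=> xD fg; rewrite !derive1E; apply: near_eq_derive.
by near=> z; apply: fg; near: z; exact: near_in_itvoo.
Unshelve. all: by end_near. Qed.

(** An a.e. identity becomes one everywhere, because w is the integral of the continuous w1. This
    allows differentiating again: [derive1n] iterates the pointwise derivative, which a.e. equality
    does not survive. *)
Lemma abs_continuous_derive1 w w1 : abs_continuous (-1) 1 w ->
  abs_continuous (-1) 1 w1 -> w1 = derive1 w %[ae mu in D] ->
  {in `]-1, 1[, derive1 w =1 w1}.
Proof.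
move=> acw acw1 ww1 x xD; have [g [ig wg gw]] := abs_continuous_density ltN11 acw.
have gw1 : g = w1 %[ae mu in D] by apply: ae_eq_trans gw _; exact: ae_eq_sym.
have mw1 := abs_continuous_measurable_oo acw1.
have cw1 := abs_continuous_continuous ltN11 acw1.
have sub y : y <= 1 -> `]-1, y[ `<=` D by move=> y1; apply: subset_itvl; rewrite bnd_simp.
have i1 : mu.-integrable `]-1, 1] (EFin \o w1).
  apply: (@integrableS _ _ _ mu `[-1, 1]); rewrite //=; first exact: subset_itv_oc_cc.
  by apply: continuous_compact_integrable => //; exact: segment_compact.
pose F y := \int[mu]_(t in `]-1, y]) w1 t.
have wF : {in `]-1, 1[, w =1 (fun y => w (-1) + F y)}.
  move=> y yD; rewrite wg; last by apply: subset_itv_oo_cc.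
  move: yD; rewrite in_itv/= => /andP[_ /ltW y1]; congr (_ + _).
  rewrite /F -Rintegral_itv_bndo_bndc; last first.
    apply: integrableS i1 => //.
    by apply: subset_itvl; rewrite bnd_simp.
  apply: ae_eq_Rintegral => //.
    by apply: (measurable_funS _ _ mw1) => //; exact: sub.
  by apply: (ae_eq_subset _ gw1); exact: sub.
rewrite (eq_oo_derive1 xD wF).
move: xD; rewrite in_itv/= => /andP[x1 x2].
have cw1x : {for x, continuous w1}.
  have /continuous_within_itvP := cw1; move=> /(_ ltN11)[+ _ _].
  by apply; rewrite in_itv/= x1.
have [] := @continuous_FTC1 R w1 (BRight (-1)) x 1 x2 i1 x1 cw1x.
rewrite -/F => dF dFx.
by rewrite derive1E (deriveD (derivable_cst _ _ _) dF) derive_cst add0r -derive1E.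
Qed.

Lemma aeq_in f g : {in `]-1, 1[, f =1 g} -> f = g %[ae mu in D].
Proof. by move=> fg; apply: aeW => x Dx; exact: fg. Qed.

Lemma derive1n_abs_continuous k u j : abs_continuous (-1) 1 u ->
  (forall i, (0 < i < k)%N -> exists2 w, abs_continuous (-1) 1 w &
     w = derive1n i u %[ae mu in D]) ->
  (j < k)%N -> exists2 w, abs_continuous (-1) 1 w & {in `]-1, 1[, derive1n j u =1 w}.
Proof.
move=> acu hw; elim: j => [|j IHj] jk; first by exists u.
have [w acw uw] := IHj (ltnW jk).
have [w1 acw1 w1u] := hw j.+1 jk.
have uw' : {in `]-1, 1[, derive1n j.+1 u =1 derive1 w}.
  by move=> x xD; rewrite derive1nS (eq_oo_derive1 xD uw).
exists w1 => // x xD; rewrite uw'//; apply: abs_continuous_derive1 => //.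
by apply: ae_eq_trans w1u _; exact: aeq_in.
Qed.

End derivative_chain.

(** * From u to its Caputo derivative *)

Section caputo_by_parts.
Context {R : realType}.
Notation mu := (@lebesgue_measure R).
Notation D := (`]-1, 1[%classic : set R).
Implicit Types (a s x : R) (j k n : nat) (f g u w : R -> R) (c : nat -> R).

Let ltN11 : -1 < 1 :> R. Proof. by lra. Qed.

Lemma derive1n_by_parts k u j n : abs_continuous (-1) 1 u ->
  (forall i, (0 < i < k)%N -> exists2 w, abs_continuous (-1) 1 w &
     w = derive1n i u %[ae mu in D]) -> (k <= n)%N -> (j <= k)%N ->
  \int[mu]_(x in D) (u x * legendre_frac n 0 x) =
  \int[mu]_(x in D) (derive1n j u x * legendre_frac n j%:R x).
Proof.
move=> acu hw kn; elim: j => [//|j IHj] jk.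
have [w acw uw] := derive1n_abs_continuous acu hw jk.
have uw' : {in `]-1, 1[, derive1n j.+1 u =1 derive1 w}.
  by move=> x xD; rewrite derive1nS (eq_oo_derive1 xD uw).
rewrite (IHj (ltnW jk)).
transitivity (\int[mu]_(x in D) (w x * legendre_frac n j%:R x)).
  by apply: eq_Rintegral => x; rewrite inE/= => /uw ->.
have B := abs_continuous_by_parts (legendre_bin n) n.+1 (ler0n R j) acw (aeq_in uw').
rewrite natr1 -!/(legendre_frac n _) in B.
have jn : (0 < j.+1 <= n)%N by rewrite (leq_trans jk kn).
rewrite (legendre_frac_nat (R := R) jn) mulr0 add0r in B.
exact: B.
Qed.

(** Since k = r + (k - r), [frac_poly] of order k is I_{1-}^(k - r) of the one of order r, and this
    fractional integral moves to the other factor. *)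
Lemma caputo_by_parts k (r : R) u v c n : (0 < k)%N -> k%:R - 1 < r <= k%:R ->
  abs_continuous (-1) 1 u ->
  (forall i, (0 < i < k)%N -> exists2 w, abs_continuous (-1) 1 w &
     w = derive1n i u %[ae mu in D]) ->
  v = caputo k r u %[ae mu in D] -> measurable_fun D v ->
  \int[mu]_(x in D) (derive1n k u x * frac_poly c n k%:R x) =
  \int[mu]_(x in D) (v x * frac_poly c n r x).
Proof.
move=> k0 /andP[kr rk] acu hw vu mv.
have mD : measurable D by exact: measurable_itv.
have mf t : measurable_fun D (frac_poly c n t).
  by apply: measurable_funTS; exact: measurable_frac_poly.
have r0 : 0 <= r.
  by apply: ltW; apply: le_lt_trans kr; rewrite subr_ge0 ler1n.
(* Order 0 is the identity by definition in [fracintL], so r = k is treated apart. *)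
have [a0|a0] := eqVneq (k%:R - r) 0.
  have kE : r = k%:R by apply/esym/eqP; rewrite -subr_eq0 a0.
  rewrite kE; apply: ae_eq_Rintegral => //; first exact: measurable_funM mv (mf _).
  apply: ae_eq_mul2r; apply: ae_eq_sym; apply: ae_eq_trans vu _.
  by rewrite /caputo a0; apply: aeq_in => x _; rewrite /fracintL eqxx.
have ap : 0 < k%:R - r by rewrite lt0r a0 subr_ge0.
have k1 : (k.-1 < k)%N by rewrite prednK.
have [w acw uw] := derive1n_abs_continuous acu hw k1.
have uw' : {in `]-1, 1[, derive1n k u =1 derive1 w}.
  by move=> x xD; rewrite -(prednK k0) derive1nS (eq_oo_derive1 xD uw).
(* g is an integrable representative of the k-th derivative of u. *)
have [g [ig _ gw]] := abs_continuous_density ltN11 acw.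
have ug : derive1n k u = g %[ae mu in D].
  by apply: ae_eq_trans (aeq_in uw') _; exact: ae_eq_sym.
have igD : mu.-integrable D (EFin \o g) by exact: integrableS ig.
have mg : measurable_fun D g by apply/measurable_EFinP; exact: measurable_int igD.
have [M fM] := frac_poly_bounded c n r0.
have fMD x : x \in `]-1, 1[ -> `|frac_poly c n r x| <= M.
  by rewrite in_itv/= => /andP[/ltW ? /ltW ?]; apply: fM; apply/andP.
transitivity (\int[mu]_(x in D) (g x * frac_poly c n k%:R x)).
  apply: ae_eq_Rintegral => //; first exact: measurable_funM mg (mf _).
  exact: ae_eq_mul2r.
transitivity (\int[mu]_(x in D) (g x * fracintR (k%:R - r) (frac_poly c n r) x)).
  apply: eq_Rintegral => x; rewrite inE/= in_itv/= => /andP[_ /ltW x1].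
  have kE : r + (k%:R - r) = k%:R by rewrite addrC subrK.
  by rewrite (fracintR_frac_poly c n ap r0 x1) kE.
rewrite -(fracint_by_parts ap igD (mf r) fMD).
apply: ae_eq_Rintegral => //; first exact: measurable_funM mv (mf _).
apply: ae_eq_mul2r; apply: ae_eq_sym; apply: ae_eq_trans vu _.
(* Replacing the k-th derivative by g under the integral leaves [caputo] unchanged at every x. *)
apply: aeq_in => x; rewrite in_itv/= => /andP[x1 x2].
rewrite /caputo /fracintL (negbTE a0); congr (_ * _).
have sub : `]-1, x[ `<=` D by apply: subset_itvl; rewrite bnd_simp ltW.
apply: ae_eq_Rintegral => //.
  apply: measurable_funM; first exact: measurable_funS mg.
  apply: measurable_funTS; under eq_fun do rewrite -powRN.
  by apply: (measurableT_comp (measurable_powR _)) => //; exact: measurable_funB.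
by apply: ae_eq_mul2r; apply: (ae_eq_subset _ ug).
Qed.

End caputo_by_parts.

(** * Stieltjes integrals without endpoint jumps *)

Section RSint_endpoint_limits.
Context {R : realType}.
Notation mu := (@lebesgue_measure R).
Implicit Types (a b x y : R) (f h phi psi : R -> R).

Lemma itv_partition_nth a b s i : itv_partition a b s -> (i <= size s)%N ->
  a <= nth b (a :: s) i <= b.
Proof.
elim: s a i => [|d s IHs] a [|i] //= abs isz.
- by rewrite lexx (itv_partition_le abs).
- by rewrite lexx (itv_partition_le abs).
have /andP[di ib] := IHs d i (itv_partition_cons abs) isz.
by rewrite ib andbT (le_trans _ di)// ltW//; case: abs => /= /andP[].
Qed.

Lemma eq_is_RSint a b phi psi h J : {in `[a, b], phi =1 psi} ->
  is_RSint a b phi h J -> is_RSint a b psi h J.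
Proof.
move=> eqp hphi e e0; have [d d0 hd] := hphi e e0; exists d => // s t /= abs st.
have := hd s t abs st; rewrite (eq_bigr (fun i : 'I__ => psi (t i) *
  (h (nth b (a :: s) i.+1) - h (nth b (a :: s) i)))) // => i _.
rewrite eqp// in_itv/=; have [_ /andP[ti it]] := st i (ltn_ord i).
have /andP[ai _] := itv_partition_nth abs (ltnW (ltn_ord i)).
have /andP[_ ib] := itv_partition_nth abs (ltn_ord i).
by rewrite (le_trans ai ti) (le_trans it ib).
Qed.

Lemma bounded_variation_dominated a b f : a <= b -> bounded_variation a b f ->
  exists W, variation_dominated a b f W.
Proof.
move=> ab BVf; exists (fine \o total_variation a ^~ f) => x y ax xy yb.
have TVfin c d : a <= c -> c <= d -> d <= b -> total_variation c d f \is a fin_num.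
  move=> ac cd db; apply/bounded_variationP => //.
  by apply: (bounded_variationl cd db); exact: (bounded_variationr ac (le_trans cd db)).
rewrite /= (total_variationD f ax xy) fineD ?TVfin// ?(le_trans xy yb)//.
rewrite addrAC subrr add0r -lee_fin fineK ?TVfin//.
exact: total_variation_ge.
Qed.

Lemma endpoint_limits_oo a b f x : x \in `]a, b[ -> endpoint_limits a b f x = f x.
Proof.
rewrite in_itv/= /endpoint_limits => /andP[ax xb].
by rewrite (gt_eqF ax) (lt_eqF xb).
Qed.

Lemma endpoint_limits_dominated a b f W : a < b -> variation_dominated a b f W ->
  exists W', variation_dominated a b (endpoint_limits a b f) W'.
Proof.
move=> ab fW; pose h := endpoint_limits a b f.
pose C := `|h a - f a| + `|h b - f b|; have C0 : 0 <= C by rewrite addr_ge0.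
(* W is increased by C at b and lowered by C at a to absorb the endpoint jumps. *)
exists (fun x => W x + (if x == b then C else 0) - (if x == a then C else 0)).
move=> x y ax xy yb; rewrite -/h.
have [->|nxy] := eqVneq x y; first by rewrite !subrr normr0.
have ltxy : x < y by rewrite lt_neqAle nxy.
have xb : x == b = false by rewrite lt_eqF// (lt_le_trans ltxy).
have ya : y == a = false by rewrite gt_eqF// (le_lt_trans ax).
rewrite xb ya subr0 addr0.
have hx : `|h x - f x| <= (if x == a then C else 0).
  case: eqVneq => [->|xna]; first by rewrite /C lerDl.
  rewrite /h endpoint_limits_oo ?subrr ?normr0// in_itv/= lt_neqAle eq_sym xna ax/=.
  by rewrite (lt_le_trans ltxy).
have hy : `|h y - f y| <= (if y == b then C else 0).
  case: eqVneq => [->|ynb]; first by rewrite /C lerDr.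
  rewrite /h endpoint_limits_oo ?subrr ?normr0// in_itv/= [y < b]lt_neqAle ynb yb andbT.
  by rewrite (le_lt_trans ax).
have := fW x y ax xy yb.
rewrite (_ : h y - h x = (h y - f y) - (h x - f x) + (f y - f x)); last by ring.
move=> fxy; apply: le_trans (ler_normD _ _) _.
have := ler_normB (h y - f y) (h x - f x); lra.
Qed.

(** [is_RSint_by_parts] for the modified integrator: its value at a is the right limit of f, the
    function integrated against it vanishes at b, and inside ]a, b[ it agrees with f. *)
Lemma is_RSint_endpoint_limits a b f psi M : a < b -> bounded_variation a b f ->
  measurable_fun [set: R] psi -> (forall x, a <= x <= b -> `|psi x| <= M) ->
  is_RSint a b (fun x => \int[mu]_(t in `]x, b[) psi t) (endpoint_limits a b f)
    (\int[mu]_(t in `]a, b[) (f t * psi t) -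
      lim (f x @[x --> a^'+]) * \int[mu]_(t in `]a, b[) psi t).
Proof.
move=> ab BVf mpsi psiM; have [W fW] := bounded_variation_dominated (ltW ab) BVf.
have [W' hW] := endpoint_limits_dominated ab fW.
have := is_RSint_by_parts (ltW ab) hW mpsi psiM.
have muoo c d : (mu `]c, d[%classic < +oo)%E.
  by rewrite lebesgue_measure_itv/=; case: ifP; rewrite -?EFinB ltry.
have ipsi x : a <= x -> mu.-integrable `]x, b[ (EFin \o psi).
  move=> ax; apply: (@bounded_integrable _ _ _ M) => //; first exact: measurable_funTS.
  by move=> t /=; rewrite in_itv/= => /andP[xt tb]; rewrite psiM// (le_trans ax (ltW xt)) ltW.
have [B hB] := variation_dominated_bounded hW.
set h := endpoint_limits a b f in hW hB *.
have ihpsi : mu.-integrable `]a, b[ (EFin \o (fun t => h t * psi t)).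
  apply: (@bounded_integrable _ _ _ (B * M)) => //.
    apply: measurable_funM; last exact: measurable_funTS.
    apply: measurable_funS (variation_dominated_measurable (ltW ab) hW) => //.
    exact: subset_itv_oo_cc.
  move=> t /=; rewrite in_itv/= => /andP[/ltW at' /ltW tb].
  by rewrite normrM ler_pM ?psiM ?hB// at'.
rewrite -(Rintegral_itv_bndo_bndc ihpsi) -(Rintegral_itv_bndo_bndc (ipsi a (lexx a))).
have -> : h a = lim (f x @[x --> a^'+]) by rewrite /h /endpoint_limits eqxx.
have -> : \int[mu]_(t in `]a, b[) (h t * psi t) = \int[mu]_(t in `]a, b[) (f t * psi t).
  by apply: eq_Rintegral => x; rewrite inE/= => /endpoint_limits_oo hx; rewrite /h hx.
apply: eq_is_RSint => x; rewrite in_itv/= => /andP[ax _].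
by rewrite (Rintegral_itv_bndo_bndc (ipsi x ax)).
Qed.

End RSint_endpoint_limits.

(** * The expansion formula *)

Section expansion.
Context {R : realType}.
Notation leb := (@lebesgue_measure R).
Notation D := (`]-1, 1[%classic : set R).
Implicit Types (f u w : R -> R) (c : nat -> R) (v : nat -> R -> R).

Let ltN11 : -1 < 1 :> R. Proof. by lra. Qed.

Lemma bounded_variation_measurable_oo f : bounded_variation (-1) 1 f -> measurable_fun D f.
Proof.
move=> /(bounded_variation_dominated (ltW ltN11))[W fW].
apply: (measurable_funS _ _ (variation_dominated_measurable (ltW ltN11) fW)) => //.
exact: subset_itv_oo_cc.
Qed.

Lemma abs_continuous_lim_right w : abs_continuous (-1) 1 w ->
  lim (w x @[x --> (-1)^'+]) = w (-1).
Proof.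
move=> /(abs_continuous_continuous ltN11)/(continuous_within_itvP _ ltN11)[_ wr _].
exact: cvg_lim wr.
Qed.

(** Unlike for the derivatives of u, the boundary terms stay: the orders r + l + 1 need not be
    integers. *)
Lemma derivatives_by_parts v c n (r : R) m : 0 <= r ->
  (forall l, (l < m)%N -> abs_continuous (-1) 1 (v l) /\
    v l.+1 = derive1 (v l) %[ae leb in D]) ->
  \int[leb]_(x in D) (v 0%N x * frac_poly c n r x) =
  \sum_(l < m) frac_poly c n (r + l%:R + 1) (-1) * v l (-1) +
  \int[leb]_(x in D) (v m x * frac_poly c n (r + m%:R) x).
Proof.
move=> r0; elim: m => [|m IHm] hv; first by rewrite big_ord0 add0r addr0.
have [acv vv] := hv m (ltnSn m).
have rm : 0 <= r + m%:R by rewrite addr_ge0.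
have hv' l : (l < m)%N -> abs_continuous (-1) 1 (v l) /\
    v l.+1 = derive1 (v l) %[ae leb in D] by move=> lm; apply: hv; exact: leqW.
have E : r + m.+1%:R = r + m%:R + 1 by rewrite -addrA natr1.
have B := abs_continuous_by_parts c n rm acv vv.
rewrite big_ord_recr/= E [frac_poly c n _ _ * v m (-1)]mulrC -addrA -B.
exact: IHm.
Qed.

Lemma Rintegral_frac_poly c n (s : R) x : 0 <= s -> x <= 1 ->
  \int[leb]_(t in `]x, 1[) frac_poly c n s t = frac_poly c n (s + 1) x.
Proof.
move=> s0 x1; rewrite -(fracintR_frac_poly c n ltr01 s0 x1) /fracintR oner_eq0.
rewrite Gamma1 invr1 mul1r; apply: eq_Rintegral => y _.
by rewrite subrr powRr0 divr1.
Qed.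

End expansion.

Theorem theorem1 (R : realType) (k : nat) (mu : R) (m : nat)
    (u : R -> R) (v : nat -> R -> R)
    (hk : (1 <= k)%N) (hmu : k%:R - 1 < mu <= k%:R)
    (hu : AC_BV_regular k mu m u v)
    (n : nat) (hn : mu + m%:R + 1 <= n%:R) :
  (exists2 J : R,
    is_RSint (-1) 1 (fracintR (mu + m%:R + 1) (fun y => (legendre R n).[y]))
      (endpoint_limits (-1) 1 (v m)) J &
    legendre_coeff u n =
      (2 * n%:R + 1) / 2 *
      (\sum_(l < m.+1)
          fracintR (mu + l%:R + 1) (fun y => (legendre R n).[y]) (-1) *
          lim (v l x @[x --> (-1)^'+])
       + J)) /\
  (forall l : nat, (l <= m)%N ->
    fracintR (mu + l%:R + 1) (fun y => (legendre R n).[y]) (-1) =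
      (-1) ^+ n * 2 `^ (mu + l%:R + 1) * Gamma (mu + l%:R + 1) *
        sin ((mu + l%:R + 1) * pi) / pi *
      (Gamma (n%:R - mu - l%:R) / Gamma (n%:R + mu + l%:R + 2))).
Proof.
have mu0 : 0 < mu by case/andP: hmu => + _; apply: le_lt_trans; rewrite subr_ge0 ler1n.
have N11 : -1 < 1 :> R by lra.
have mul0 l : 0 <= mu + l%:R by rewrite addr_ge0// ltW.
have mul10 l : 0 <= mu + l%:R + 1 by rewrite addr_ge0.
have N1le1 := ltW N11.
have fracintRE l x : x <= 1 -> fracintR (mu + l%:R + 1) (fun y => (legendre R n).[y]) x =
    legendre_frac n (mu + l%:R + 1) x.
  by move=> x1; exact: fracintR_legendre.
(* From mu > k - 1 the bound on n gives n > k + m. *)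
have kn : (k <= n)%N.
  rewrite -(@ler_nat R); apply: le_trans hn; have /andP[kmu _] := hmu.
  by have : 0 <= m%:R :> R by []; lra.
split; last first.
  move=> l lm; rewrite fracintRE// legendre_frac_N1; last first.
    (* The bound on n keeps the order below n + 1, so that Gamma (n - mu - l) has a positive
       argument. *)
    apply/andP; split; first by rewrite ltr_wpDl.
    apply: (@le_lt_trans _ _ n%:R); last by rewrite ltr_nat.
    by apply: le_trans hn; rewrite lerD2r lerD2l ler_nat.
  have <- : n.+1%:R - (mu + l%:R + 1) = n%:R - mu - l%:R by rewrite -natr1; ring.
  by have <- : n.+1%:R + (mu + l%:R + 1) = n%:R + mu + l%:R + 2 by rewrite -natr1; ring.
case: hu => acu hw [v0 BV0] hv BVm.
have I0 : \int[lebesgue_measure]_(x in `[-1, 1]) (u x * (legendre R n).[x]) =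
    \int[lebesgue_measure]_(x in `]-1, 1[) (u x * legendre_frac n 0 x).
  transitivity (\int[lebesgue_measure]_(x in `[-1, 1]) (u x * legendre_frac n 0 x)).
    apply: eq_Rintegral => x; rewrite inE/= in_itv/= => /andP[_ x1].
    by rewrite legendreE.
  congr fine; apply: integral_itv_bndoo.
  apply/measurable_EFinP; apply: measurable_funM; first exact: abs_continuous_measurable_oo.
  by apply: measurable_funTS; exact: measurable_frac_poly.
have I1 := derive1n_by_parts acu hw kn (leqnn k).
have I2 := caputo_by_parts (legendre_bin n) n.+1 hk hmu acu hw v0
  (bounded_variation_measurable_oo BV0).
have I3 := derivatives_by_parts (legendre_bin n) n.+1 (ltW mu0) hv.
have [M psiM] := frac_poly_bounded (legendre_bin n) n.+1 (mul0 m).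
(* Here psi is I_{1-}^(mu + m) P_n, whose integral over ]x, 1[ is I_{1-}^(mu + m + 1) P_n at x. *)
have RS := is_RSint_endpoint_limits N11 BVm
  (measurable_frac_poly (legendre_bin n) n.+1 (mu + m%:R)) psiM.
eexists.
  apply: eq_is_RSint RS => x; rewrite in_itv/= => /andP[_ x1].
  rewrite (fracintRE m x x1); exact: (Rintegral_frac_poly (legendre_bin n) n.+1 (mul0 m) x1).
rewrite /legendre_coeff I0 I1 (etrans I2 I3).
rewrite (Rintegral_frac_poly _ _ (mul0 m) N1le1) big_ord_recr/= (fracintRE m _ N1le1).
rewrite -/(legendre_frac n (mu + m%:R + 1)); congr (_ * _).
(* For l < m the function [v l] is continuous up to -1, so its right limit is its value; the term l
   = m comes from the Stieltjes part, already with the limit. *)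
have -> : \sum_(l < m) fracintR (mu + l%:R + 1) (fun y => (legendre R n).[y]) (-1) *
    lim (v l x @[x --> (-1)^'+]) =
  \sum_(l < m) frac_poly (legendre_bin n) n.+1 (mu + l%:R + 1) (-1) * v l (-1).
  apply: eq_bigr => l _; have [acv _] := hv l (ltn_ord l).
  by rewrite (abs_continuous_lim_right acv) (fracintRE l _ N1le1).
set S := \sum_(l < m) _; set L := lim _; set I := Rintegral _ _ _; set p := legendre_frac _ _ _.
by ring.
Qed.
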